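(* For every pair of positive integers $k,t$, there exists a vertically $k$-connected dyadic matroid $M$ that is neither a rank-$(\leq t)$ perturbation of a (represented) frame matroid nor a rank-$(\leq t)$ perturbation of the dual of a (represented) frame matroid.
   Context: A matroid is dyadic if it is representable over both $\mathrm{GF}(3)$ and $\mathrm{GF}(5)$. Dyadic matroids are ternary, and ternary matroids are uniquely $\mathrm{GF}(3)$-representable, so a dyadic matroid is identified with its (unique up to row operations and column scaling) $\mathrm{GF}(3)$-representation; all perturbations are over $\mathrm{GF}(3)$. An $\mathbb{F}$-represented matroid is a matroid together with a fixed class of representation matrices over $\mathbb{F}$ that are row equivalent up to column scaling and removal of zero rows; $M(A)$ denotes the vector matroid of $A$. A represented frame matroid is one with a representation matrix having at most two nonzero entries in each column. If $M_1,M_2$ are $\mathbb{F}$-represented matroids on a common ground set, $M_2$ is a rank-$(\leq t)$ perturbation of $M_1$ if there are matrices $A_1,P$ with $M(A_1)=M_1$, $\mathrm{rank}(P)\le t$ and $M(A_1+P)=M_2$. A matroid $M$ is vertically $k$-connected if for every partition $(A,B)$ of $E(M)$ with $r(A)+r(B)-r(M)<k-1$, one of $A$ or $B$ spans $E(M)$. *)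

(* Defs.v *)
From HB Require Import structures.
From mathcomp Require Import all_boot all_order all_algebra.
Set Implicit Arguments.
Unset Strict Implicit.
Unset Printing Implicit Defensive.
Import GRing.Theory.
Local Open Scope ring_scope.

Record matroid (T : finType) := Matroid {
  indep : {set {set T}};
  indep0 : set0 \in indep;
  indepS : forall X Y : {set T}, Y \in indep -> X \subset Y -> X \in indep;
  indep_aug : forall X Y : {set T}, X \in indep -> Y \in indep ->
    (#|X| < #|Y|)%N -> exists2 e, e \in Y :\: X & e |: X \in indep
}.

Definition mrank (T : finType) (M : matroid T) (X : {set T}) : nat :=
  \max_(I in indep M | I \subset X) #|I|.

Definition mclosure (T : finType) (M : matroid T) (X : {set T}) : {set T} :=
  [set e | mrank M (e |: X) == mrank M X].

Definition spans (T : finType) (M : matroid T) (X : {set T}) : Prop :=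
  mclosure M X = [set: T].

(* The subtractions are in nat; they never truncate when 0 < k, since
   r(A) + r(B) >= r(E) whenever A and B cover E. *)
Definition vertically_connected (T : finType) (k : nat) (M : matroid T) : Prop :=
  forall A B : {set T}, A :|: B = [set: T] -> A :&: B = set0 ->
    (mrank M A + mrank M B - mrank M [set: T] < k - 1)%N ->
    spans M A \/ spans M B.

Definition cols (F : fieldType) (m n : nat) (A : 'M[F]_(m, n))
    (X : {set 'I_n}) : 'M[F]_(m, #|X|) :=
  colsub (fun i : 'I_#|X| => enum_val i) A.

Definition vindep (F : fieldType) (m n : nat) (A : 'M[F]_(m, n)) :
    {set {set 'I_n}} :=
  [set X : {set 'I_n} | \rank (cols A X) == #|X|].

Definition colspan (F : fieldType) (m n : nat) (A : 'M[F]_(m, n))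
    (X : {set 'I_n}) : 'M[F]_m :=
  (\sum_(i in X) <<row i A^T>>)%MS.

Lemma cols_colspan (F : fieldType) (m n : nat) (A : 'M[F]_(m, n))
    (X : {set 'I_n}) :
  ((cols A X)^T :=: colspan A X)%MS.
Proof.
apply/eqmxP/andP; split.
  apply/row_subP => i; have -> : row i (cols A X)^T = row (enum_val i) A^T.
    by apply/rowP => j; rewrite !mxE.
  by apply: (sumsmx_sup (enum_val i)); [exact: enum_valP | rewrite genmxE].
apply/sumsmx_subP => i iX; rewrite genmxE.
have -> : row i A^T = row (enum_rank_in iX i) (cols A X)^T.
  by apply/rowP => j; rewrite !mxE enum_rankK_in.
exact: row_sub.
Qed.

Lemma in_vindep (F : fieldType) (m n : nat) (A : 'M[F]_(m, n))
    (X : {set 'I_n}) :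
  (X \in vindep A) = (\rank (colspan A X) == #|X|).
Proof. by rewrite inE -mxrank_tr cols_colspan. Qed.

Lemma rank_colspan (F : fieldType) (m n : nat) (A : 'M[F]_(m, n))
    (X : {set 'I_n}) :
  (\rank (colspan A X) <= #|X|)%N.
Proof. by rewrite -cols_colspan rank_leq_row. Qed.

Lemma vindep0 (F : fieldType) (m n : nat) (A : 'M[F]_(m, n)) :
  set0 \in vindep A.
Proof. by rewrite in_vindep /colspan big_set0 mxrank0 cards0. Qed.

Lemma vindepS (F : fieldType) (m n : nat) (A : 'M[F]_(m, n))
    (X Y : {set 'I_n}) :
  Y \in vindep A -> X \subset Y -> X \in vindep A.
Proof.
rewrite !in_vindep => /eqP rY sXY; rewrite eqn_leq rank_colspan /=.
have := mxrank_adds_leqif (colspan A X) (colspan A (Y :\: X)).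
have -> : (colspan A X + colspan A (Y :\: X))%MS = colspan A Y.
  by rewrite /colspan [RHS](big_setID X) /= (setIidPr sXY).
rewrite rY -(cardsID X Y) (setIidPr sXY) => -[le _].
rewrite -(leq_add2r #|Y :\: X|); apply: leq_trans le _.
by rewrite leq_add2l rank_colspan.
Qed.

Lemma vindep_aug (F : fieldType) (m n : nat) (A : 'M[F]_(m, n))
    (X Y : {set 'I_n}) :
  X \in vindep A -> Y \in vindep A -> (#|X| < #|Y|)%N ->
  exists2 e, e \in Y :\: X & e |: X \in vindep A.
Proof.
move=> iX iY ltXY; apply/exists_inP; apply: contraLR ltXY => /exists_inPn no.
move: iX iY no; rewrite !in_vindep -leqNgt => /eqP rX /eqP <- no.
rewrite -rX; apply: mxrankS; apply/sumsmx_subP => e eY.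
have [eX | eX] := boolP (e \in X); first exact: (sumsmx_sup e).
have := no e; rewrite inE eX eY => /(_ isT); rewrite in_vindep cardsU1 eX add1n.
have -> : colspan A (e |: X) = (<<row e A^T>> + colspan A X)%MS.
  by rewrite /colspan big_setU1.
rewrite eqn_leq => /nandP[|].
  have := mxrank_adds_leqif <<row e A^T>>%MS (colspan A X).
  case=> le _; rewrite (leq_trans le) // rX -[#|X|.+1]add1n leq_add2r.
  by rewrite genmxE rank_leq_row.
rewrite -ltnNge ltnS -rX => le.
have /eqmxP eq : (colspan A X == <<row e A^T>> + colspan A X)%MS.
  by rewrite -(geq_leqif (mxrank_leqif_eq (addsmxSr _ _))).
by rewrite eq addsmxSl.
Qed.

Definition vector_matroid (F : fieldType) (m n : nat) (A : 'M[F]_(m, n)) :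
    matroid 'I_n :=
  Matroid (vindep0 A) (@vindepS F m n A) (@vindep_aug F m n A).

Definition representable (F : fieldType) (n : nat) (M : matroid 'I_n) : Prop :=
  exists (m : nat) (A : 'M[F]_(m, n)), indep (vector_matroid A) = indep M.

Definition dyadic (n : nat) (M : matroid 'I_n) : Prop :=
  representable 'F_3 M /\ representable 'F_5 M.

Inductive rep_equiv (F : fieldType) (n : nat) :
    forall m1 m2 : nat, 'M[F]_(m1, n) -> 'M[F]_(m2, n) -> Prop :=
| rep_row_op m (U : 'M[F]_m) (A : 'M[F]_(m, n)) :
    U \in unitmx -> rep_equiv A (U *m A)
| rep_col_scale m (d : 'rV[F]_n) (A : 'M[F]_(m, n)) :
    (forall j, d 0 j != 0) -> rep_equiv A (A *m diag_mx d)
| rep_zero_row m (i : 'I_m) (A : 'M[F]_(m, n)) :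
    row i A = 0 -> rep_equiv A (row' i A)
| rep_sym m1 m2 (A : 'M[F]_(m1, n)) (B : 'M[F]_(m2, n)) :
    rep_equiv A B -> rep_equiv B A
| rep_trans m1 m2 m3 (A : 'M[F]_(m1, n)) (B : 'M[F]_(m2, n))
    (C : 'M[F]_(m3, n)) :
    rep_equiv A B -> rep_equiv B C -> rep_equiv A C.

(* A represented matroid is given by one matrix of its class, so equality of
   represented matroids is rmatroid_eq, not Leibniz equality; the notions
   below only depend on the class (underlying_eq, rdual_eq). *)
Record rmatroid (F : fieldType) (n : nat) := RMatroid {
  rm_rows : nat;
  rm_mx : 'M[F]_(rm_rows, n)
}.

Definition rmatroid_eq (F : fieldType) (n : nat) (M N : rmatroid F n) : Prop :=
  rep_equiv (rm_mx M) (rm_mx N).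

Definition underlying (F : fieldType) (n : nat) (M : rmatroid F n) :
    matroid 'I_n :=
  vector_matroid (rm_mx M).

Definition frame (F : fieldType) (n : nat) (M : rmatroid F n) : Prop :=
  exists (m : nat) (A : 'M[F]_(m, n)),
    rmatroid_eq (RMatroid A) M /\
    forall j : 'I_n, (#|[set i : 'I_m | A i j != 0%R]| <= 2)%N.

(* The rows of kermx A^T span the orthogonal complement of the row space of A;
   when A = [I | D] this is the row space of [-D^T | I]. *)
Definition rdual (F : fieldType) (n : nat) (M : rmatroid F n) : rmatroid F n :=
  RMatroid (kermx (rm_mx M)^T).

Definition perturbation (F : fieldType) (n t : nat) (M1 M2 : rmatroid F n) :
    Prop :=
  exists (m : nat) (A1 P : 'M[F]_(m, n)),
    [/\ rmatroid_eq (RMatroid A1) M1,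
        (\rank P <= t)%N
      & rmatroid_eq (RMatroid (A1 + P)) M2].

Lemma diag_mx_unit (F : fieldType) n (d : 'rV[F]_n) :
  (forall j, d 0 j != 0) -> diag_mx d \in unitmx.
Proof. by move=> nz; rewrite unitmxE det_diag unitfE; apply/prodf_neq0 => j _. Qed.

Lemma mul_diag_mxV (F : fieldType) n (d : 'rV[F]_n) : (forall j, d 0 j != 0) ->
  diag_mx d *m diag_mx (\row_j (d 0 j)^-1) = 1%:M.
Proof.
move=> nz; rewrite mulmx_diag -diag_const_mx; congr diag_mx.
by apply/rowP => j; rewrite !mxE divff.
Qed.

Lemma rep_equiv_rowspace (F : fieldType) n m1 m2 (A : 'M[F]_(m1, n)) (B : 'M[F]_(m2, n)) :
  rep_equiv A B -> exists2 d : 'rV[F]_n, forall j, d 0 j != 0 & (A *m diag_mx d :=: B)%MS.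
Proof.
elim=> {m1 m2 A B}.
- move=> m U A uU; exists (const_mx 1) => [j|]; first by rewrite mxE oner_neq0.
  rewrite diag_const_mx mulmx1; apply: eqmx_sym; apply: eqmxMfull.
  by rewrite row_full_unit.
- by move=> m d A nz; exists d.
- move=> m i A z; exists (const_mx 1) => [j|]; first by rewrite mxE oner_neq0.
  rewrite diag_const_mx mulmx1; apply/eqmxP/andP; split; apply/row_subP => j.
    have [j' ->| ->] := unliftP i j; last by rewrite z sub0mx.
    have -> : row (lift i j') A = row j' (row' i A) by apply/rowP => x; rewrite !mxE.
    exact: row_sub.
  have -> : row j (row' i A) = row (lift i j) A by apply/rowP => x; rewrite !mxE.
  exact: row_sub.
- move=> m1 m2 A B _ [d nz eAB]; exists (\row_j (d 0 j)^-1) => [j|].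
    by rewrite mxE invr_neq0.
  apply: eqmx_trans (eqmxMr _ (eqmx_sym eAB)) _.
  by rewrite -mulmxA mul_diag_mxV // mulmx1.
- move=> m1 m2 m3 A B C _ [d nz eAB] _ [e nze eBC].
  exists (\row_j (d 0 j * e 0 j)) => [j|]; first by rewrite mxE mulf_neq0.
  rewrite -mulmx_diag mulmxA; exact: eqmx_trans (eqmxMr _ eAB) eBC.
Qed.

Lemma rep_refl (F : fieldType) n m (A : 'M[F]_(m, n)) : rep_equiv A A.
Proof. by rewrite -{2}[A]mul1mx; apply: rep_row_op; rewrite unitmx1. Qed.

Lemma rep_cast (F : fieldType) n m m' (e : m = m') (A : 'M[F]_(m, n)) (B : 'M[F]_(m',n)) :
  B = castmx (e, erefl n) A -> rep_equiv A B.
Proof. by case: _ / e B => B; rewrite castmx_id => ->; apply: rep_refl. Qed.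

Lemma rep_col0 (F : fieldType) n m p (A : 'M[F]_(m, n)) :
  rep_equiv (col_mx A (0 : 'M_(p,n))) A.
Proof.
elim: p => [|p IH].
  apply: (rep_cast (e := addn0 m)).
  apply/matrixP => i j; rewrite castmxE /= cast_ord_id.
  have -> : cast_ord (esym (addn0 m)) i = lshift 0 i by apply: val_inj.
  by rewrite col_mxEu.
apply: rep_trans IH.
have := @rep_zero_row F n (m + p.+1) (rshift m (ord_max : 'I_p.+1)) (col_mx A 0).
have -> : row (rshift m (ord_max : 'I_p.+1)) (col_mx A (0 : 'M[F]_(p.+1, n))) = 0 :> 'rV[F]_n.
  by apply/rowP => j; rewrite mxE col_mxEd !mxE.
move/(_ erefl) => H; apply: rep_trans H _.
have e : ((m + p.+1).-1 = m + p)%N by rewrite addnS.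
apply: (rep_cast (e := e)).
apply/matrixP => i j; rewrite castmxE /= cast_ord_id [RHS]mxE.
case: (splitP i) => i' ei.
  have -> : i = lshift p i' by apply: val_inj.
  have -> : lift (rshift m ord_max) (cast_ord (esym e) (lshift p i')) = lshift p.+1 i'.
    apply: val_inj; rewrite /= /bump leqNgt.
    by rewrite (leq_trans (ltn_ord i')) // leq_addr.
  by rewrite !col_mxEu.
have -> : i = rshift m i' by apply: val_inj.
have -> : lift (rshift m ord_max) (cast_ord (esym e) (rshift m i')) = rshift m (widen_ord (leqnSn p) i').
  by apply: val_inj; rewrite /= /bump leqNgt ltn_add2l ltn_ord.
by rewrite !col_mxEd !mxE.
Qed.

Lemma rep_base (F : fieldType) n m (A : 'M[F]_(m, n)) : rep_equiv A (row_base A).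
Proof.
have e : (\rank A + (m - \rank A) = m)%N by rewrite subnKC ?rank_leq_row.
apply: rep_trans (rep_col0 (m - \rank A) _).
apply: (@rep_trans _ _ _ _ _ _ (castmx (e, erefl n) (col_mx (row_base A) (0 : 'M_(m - \rank A,n))))); last first.
  by apply: rep_sym; apply: (rep_cast (e := e)).
apply: rep_sym; set C := castmx _ _.
have -> : A = col_ebase A *m C; last by apply: rep_row_op; exact: col_ebase_unit.
rewrite -{1}(mulmx_ebase A) -mulmxA; congr (_ *m _).
apply/matrixP => i j; rewrite castmxE /= cast_ord_id.
case: (splitP (cast_ord (esym e) i)) => i' ei.
  have -> : cast_ord (esym e) i = lshift _ i' by apply: val_inj.
  rewrite col_mxEu /row_base mxE [RHS]mxE; apply: eq_bigr => l _.
  by rewrite !mxE -ei /= .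
have -> : cast_ord (esym e) i = rshift _ i' by apply: val_inj.
rewrite col_mxEd mxE mxE big1 // => l _; rewrite mxE.
by move: ei => /= ->; rewrite ltnNge leq_addr andbF mul0r.
Qed.

Lemma rowspace_rep_equiv (F : fieldType) n m1 m2 (A : 'M[F]_(m1, n)) (B : 'M[F]_(m2, n)) :
  (A :=: B)%MS -> rep_equiv A B.
Proof.
move=> eAB; apply: rep_trans (rep_base A) _; apply: rep_trans (rep_sym (rep_base B)).
have : (row_base B <= row_base A)%MS by rewrite !eq_row_base eAB.
case/submxP => D eD.
have e : \rank A = \rank B by rewrite eAB.
move: (row_base_free A) (row_base_free B) eD; move: (row_base A) (row_base B) D.
case: _ / e => a b D fa fb eD; rewrite eD; apply: rep_row_op.
rewrite -row_free_unit -kermx_eq0; move: fb; rewrite -kermx_eq0 => /eqP kb.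
rewrite -submx0 -kb; apply/sub_kermxP; by rewrite eD mulmxA mulmx_ker mul0mx.
Qed.

Lemma rdual_eq (F : fieldType) n (M N : rmatroid F n) :
  rmatroid_eq M N -> rmatroid_eq (rdual M) (rdual N).
Proof.
case/rep_equiv_rowspace => d nz e; rewrite /rmatroid_eq /=.
move: (rm_mx M) (rm_mx N) e => A B e.
pose d' := \row_j (d 0 j)^-1.
have nz' j : d' 0 j != 0 by rewrite mxE invr_neq0.
have dd' : diag_mx d *m diag_mx d' = 1%:M by apply: mul_diag_mxV.
have d'd : diag_mx d' *m diag_mx d = 1%:M by apply: mulmx1C.
apply: rep_trans (rep_col_scale _ nz') _; apply: rowspace_rep_equiv.
apply/eqmxP/andP; split.
  apply/sub_kermxP. have /submxP[D ->] : (B <= A *m diag_mx d)%MS by rewrite e.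
  by rewrite !trmx_mul tr_diag_mx mulmxA -(mulmxA _ (diag_mx d')) (mulmxA (diag_mx d')) d'd mul1mx mulmx_ker mul0mx.
rewrite -[X in (X <= _)%MS]mulmx1 -dd' mulmxA submxMr //; apply/sub_kermxP.
have /submxP[D eD] : (A *m diag_mx d <= B)%MS by rewrite e.
by rewrite -mulmxA -[diag_mx d]tr_diag_mx -trmx_mul eD trmx_mul mulmxA mulmx_ker mul0mx.
Qed.

Lemma underlying_eq (F : fieldType) n (M N : rmatroid F n) :
  rmatroid_eq M N -> indep (underlying M) = indep (underlying N).
Proof.
case/rep_equiv_rowspace => d nz e; rewrite /underlying /=.
move: (rm_mx M) (rm_mx N) e => A B e; apply/setP => X; rewrite !inE.
suff -> : \rank (cols A X) = \rank (cols B X) by [].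
have colsE m (C : 'M[F]_(m, n)) : cols C X = C *m cols 1%:M X.
  by rewrite /cols mulmx_colsub mulmx1.
rewrite (colsE _ B) -(eqmxMr _ e) -mulmxA.
have -> : diag_mx d *m cols 1%:M X = cols 1%:M X *m diag_mx (\row_j d 0 (enum_val j)).
  apply/matrixP => i j; rewrite mul_diag_mx mul_mx_diag !mxE mulrC.
  by case: eqP => [->|]; rewrite ?mul0r ?mul1r.
rewrite mulmxA -colsE -[RHS]mxrank_tr trmx_mul tr_diag_mx eqmxMfull ?mxrank_tr //.
by rewrite row_full_unit diag_mx_unit // => j; rewrite mxE.
Qed.

(* Main.v *)
Require Import Defs.
From mathcomp Require Import all_boot all_order all_algebra.
From mathcomp Require Import zify ring.

(**
The matroid is the bond matroid of a graph H, enriched by points that destroy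
its coframe structure only locally.  A bond matroid stays vertically
k-connected as long as every separation of small order has an acyclic side, so
H may be taken sparse with huge girth, and adding points inside spans of
existing elements never hurts vertical connectivity.

Let the flows on H be conserved everywhere except at a few terminals far apart
on a path.  An edge e at a terminal is then subject to a single conservation
law.  For a triple e1, e2, e3 of such edges add the four points
e1 +- e2 +- e3, which complete it to a non-Fano configuration.  Every
subspace spanned by points of a non-Fano configuration is defined by equations
x = 0 and x = +- y, so linear dependence in the whole matroid is governed by
a system of equations of this kind.  Odd functions between two fields of
characteristic different from 2 map solutions of such systems to solutions,
hence the matroid is the same over GF(3) and GF(5).

A perturbation of rank at most t shares with the original row space a subspace
of codimension at most t, and a (co)frame matroid is described by a matrix with
at most two nonzero entries in each column.  For a perturbed frame matroid, any
t + 1 rows of this matrix combine to a flow of H, which has large support; this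
needs more nonzero entries than there are.  For a perturbed dual of a frame
matroid, contract everything off the path; each segment of the path between
consecutive terminals becomes a point lying in two gadgets, and what remains is
a simple matroid of rank 3G with 11G elements.  All but O(t) rows of the
sparse matrix are relations of this matroid, hence have at least three nonzero
entries, and 3 (11G - 3G) exceeds 2 (11G).
*)

Set Implicit Arguments.
Unset Strict Implicit.
Unset Printing Implicit Defensive.
Import GRing.Theory.
Local Open Scope ring_scope.

(** * Rank of families of vectors and of edge sets *)

Section FamilyRank.
Variables (F : fieldType) (T : finType) (v : nat) (f : T -> 'rV[F]_v).

Definition spanf (A : {set T}) : 'M[F]_v := (\sum_(x in A) <<f x>>)%MS.
Definition rkf (A : {set T}) : nat := \rank (spanf A).

Lemma spanf_mem (A : {set T}) x : x \in A -> (f x <= spanf A)%MS.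
Proof. by move=> xA; apply: (sumsmx_sup x); rewrite ?genmxE. Qed.

Lemma spanf_subP (A : {set T}) m (U : 'M_(m, v)) :
  reflect (forall x, x \in A -> (f x <= U)%MS) (spanf A <= U)%MS.
Proof.
by apply: (iffP sumsmx_subP) => h x /h; rewrite genmxE.
Qed.

Lemma spanfS (A B : {set T}) : A \subset B -> (spanf A <= spanf B)%MS.
Proof. by move=> /subsetP sAB; apply/spanf_subP => x /sAB /spanf_mem. Qed.

Lemma rkfS (A B : {set T}) : A \subset B -> (rkf A <= rkf B)%N.
Proof. by move=> /spanfS; apply: mxrankS. Qed.

Lemma spanfU A B : (spanf (A :|: B) :=: spanf A + spanf B)%MS.
Proof.
apply/eqmxP/andP; split; last first.
  by rewrite addsmx_sub !spanfS ?subsetUl ?subsetUr.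
apply/spanf_subP => x; rewrite inE => /orP[] /spanf_mem h.
  by apply: submx_trans h _; rewrite addsmxSl.
by apply: submx_trans h _; rewrite addsmxSr.
Qed.

Lemma rkfU A B : (rkf (A :|: B) <= rkf A + rkf B)%N.
Proof. by rewrite /rkf spanfU; apply: mxrank_adds_leqif. Qed.

Lemma rkf_card A : (rkf A <= #|A|)%N.
Proof.
rewrite /rkf /spanf -sum1_card.
elim/big_ind2: _ => [|U a W b hU hW|x _]; first by rewrite mxrank0.
  by apply: leq_trans (mxrank_adds_leqif _ _).1 (leq_add hU hW).
by rewrite genmxE rank_leq_row.
Qed.

Lemma rkf_dep_mem x (A : {set T}) : x \notin A -> rkf A = #|A| ->
  rkf (x |: A) <> #|x |: A| -> (f x <= spanf A)%MS.
Proof.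
move=> xA fA dA.
have r : (rkf (x |: A) <= rkf A)%N.
  rewrite fA; have := rkf_card (x |: A); move: dA; rewrite cardsU1 xA; lia.
have /eqmxP eq : (spanf A == spanf (x |: A))%MS.
  by rewrite -(geq_leqif (mxrank_leqif_eq (spanfS _))) // subsetUr.
by rewrite eq spanf_mem // setU11.
Qed.

End FamilyRank.

Section Crossing.
Variables (F : fieldType) (T : finType) (v : nat) (s t : T -> 'I_v).

Definition evec (x : T) : 'rV[F]_v := delta_mx 0 (s x) - delta_mx 0 (t x).

Definition ind (S : pred 'I_v) : 'cV[F]_v := \col_u (S u)%:R.

Lemma evec_ind x S : (evec x *m ind S) 0 0 = (S (s x))%:R - (S (t x))%:R.
Proof.
rewrite mulmxBl -!rowE !mxE //.
Qed.

Definition lipschitz (phi : 'I_v -> nat) (A : {set T}) :=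
  forall x, x \in A -> (phi (s x) <= phi (t x) + 1)%N /\ (phi (t x) <= phi (s x) + 1)%N.

Definition crosses (phi : 'I_v -> nat) c (x : T) :=
  (phi (s x) <= c)%N != (phi (t x) <= c)%N.

(** Choose one crossing edge for each level. A Lipschitz edge crosses at most one level, so pairing
    the chosen edge vectors with the indicators of the sublevel sets gives a diagonal matrix with
    entries 1 or -1, and these vectors are independent. *)
Lemma crossing_rank phi (A : {set T}) a n : lipschitz phi A ->
  (forall c, (a <= c < a + n)%N -> exists2 x, x \in A & crosses phi c x) ->
  (n <= rkf evec A)%N.
Proof.
move=> lip hc.
have hx (c : 'I_n) : exists x, (x \in A) && crosses phi (a + c) x.
  have hb : (a <= a + c < a + n)%N by rewrite leq_addr ltn_add2l /=.
  by have [x xA cx] := hc _ hb; exists x; rewrite xA.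
pose x c := xchoose (hx c).
have xP c : (x c \in A) && crosses phi (a + c) (x c) := xchooseP (hx c).
pose R := \matrix_(c < n) evec (x c).
pose Phi := \matrix_(u < v, c < n) ((phi u <= a + c)%N%:R : F).
pose d := \row_c (R *m Phi) c c.
have E : R *m Phi = diag_mx d.
  apply/matrixP => c c'; rewrite [RHS]mxE [d 0 c]mxE.
  have [<-|ne] := eqVneq c c'; first by rewrite mulr1n.
  rewrite mulr0n.
  have -> : (R *m Phi) c c' = (evec (x c) *m ind (fun u => phi u <= a + c')%N) 0 0.
    by rewrite !mxE; apply: eq_bigr => u _; rewrite !mxE.
  rewrite evec_ind; have /andP[xA] := xP c; rewrite /crosses.
  have [] := lip _ xA => l1 l2 hcr.
  have -> : (phi (s (x c)) <= a + c')%N = (phi (t (x c)) <= a + c')%N.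
    have : (c : nat) != c' by []. 
    move: hcr l1 l2; move: (phi _) (phi _) => p q; lia.
  by rewrite subrr.
have dn0 c : d 0 c != 0.
  rewrite mxE.
  have -> : (R *m Phi) c c = (evec (x c) *m ind (fun u => phi u <= a + c)%N) 0 0.
    by rewrite !mxE; apply: eq_bigr => u _; rewrite !mxE.
  rewrite evec_ind; have /andP[_] := xP c; rewrite /crosses.
  by do 2 case: leqP => _ //=; rewrite ?subr0 ?sub0r ?oppr_eq0 oner_eq0.
have rn : \rank (R *m Phi) = n.
  rewrite E; apply/eqP; rewrite -[_ == n]/(row_free _) row_free_unit; exact: diag_mx_unit.
rewrite -{1}rn; apply: leq_trans (mxrankM_maxl _ _) _; apply: mxrankS.
apply/row_subP => c; rewrite rowK; apply: spanf_mem; by have /andP[] := xP c.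
Qed.

End Crossing.

(** * Linked graphs of large girth *)

Lemma cross_exists (F : fieldType) (T : finType) v (s t : T -> 'I_v)
    (A : {set T}) (y : 'rV[F]_v) (S : pred 'I_v) :
  (y <= spanf (evec F s t) A)%MS -> (y *m ind F S) 0 0 != 0 ->
  exists2 x, x \in A & S (s x) != S (t x).
Proof.
move=> yA; have [/exists_inP //|/exists_inPn no] :=
  boolP [exists x in A, S (s x) != S (t x)].
rewrite (_ : y *m _ = 0) ?mxE ?eqxx //.
apply/sub_kermxP; apply: submx_trans yA _; apply/spanf_subP => x xA.
apply/sub_kermxP/matrixP => i j; rewrite !ord1 evec_ind mxE.
suff -> : S (s x) = S (t x) by rewrite subrr.
by apply/eqP; rewrite -[_ == _]negbK no.
Qed.

Section Balls.
Variable v : nat.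
Implicit Type E : {set 'I_v * 'I_v}.

Definition incident E u := [set x in E | (x.1 == u) || (x.2 == u)].
Definition adjacent E u w := ((u, w) \in E) || ((w, u) \in E).
Definition neighbours E (B : {set 'I_v}) := [set w | [exists b in B, adjacent E b w]].
Definition ball E u c := iter c (fun B => B :|: neighbours E B) [set u].
(** The distance from [u] to [w] truncated at [n], written as the number of radii below [n] whose
    ball misses [w]. *)
Definition level E u n w := (\sum_(c < n) (w \notin ball E u c))%N.

Lemma ballS E u c : ball E u c.+1 = ball E u c :|: neighbours E (ball E u c).
Proof. by []. Qed.

Lemma ball_mono E u c c' : (c <= c')%N -> ball E u c \subset ball E u c'.
Proof.
elim: c' => [|c' IH]; first by rewrite leqn0 => /eqP->.
rewrite leq_eqVlt => /predU1P[->//|]; rewrite ltnS => /IH h.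
by rewrite ballS; apply: subset_trans h (subsetUl _ _).
Qed.

Lemma center_ball E u c : u \in ball E u c.
Proof. by apply: (subsetP (ball_mono E u (leq0n c))); rewrite inE. Qed.

Lemma adjacent_sym E u w : adjacent E u w = adjacent E w u.
Proof. by rewrite /adjacent orbC. Qed.

Lemma adjacent_ball E u c b w :
  adjacent E b w -> b \in ball E u c -> w \in ball E u c.+1.
Proof.
move=> adj bB; rewrite ballS !inE; apply/orP; right.
by apply/existsP; exists b; rewrite bB.
Qed.

Lemma card_neighbours E d B : (forall u, #|incident E u| <= d)%N ->
  (#|neighbours E B| <= #|B| * d)%N.
Proof.
move=> hd.
pose other b (x : 'I_v * 'I_v) := if x.1 == b then x.2 else x.1.
have sub : neighbours E B \subset \bigcup_(b in B) (other b @: incident E b).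
  apply/subsetP => w; rewrite inE => /existsP[b /andP[bB adj]].
  apply/bigcupP; exists b => //; case/orP: adj => h.
    by apply/imsetP; exists (b, w); rewrite ?inE ?h ?eqxx // /other eqxx.
  apply/imsetP; exists (w, b); rewrite ?inE ?h ?eqxx ?orbT // /other /=.
  by case: eqP.
apply: leq_trans (subset_leq_card sub) _.
rewrite -sum_nat_const.
elim/big_ind2: _ => [|X a Y c hX hY|b _]; first by rewrite cards0.
  by apply: leq_trans (leq_card_setU _ _) (leq_add hX hY).
by apply: leq_trans (leq_imset_card _ _) _.
Qed.

Lemma card_ball E d u c : (forall u, #|incident E u| <= d)%N ->
  (#|ball E u c| <= d.+1 ^ c)%N.
Proof.
move=> hd; elim: c => [|c IH]; first by rewrite cards1.
rewrite ballS; apply: leq_trans (leq_card_setU _ _) _.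
rewrite expnS mulSn; apply: leq_add => //.
by apply: leq_trans (card_neighbours _ hd) _; rewrite mulnC leq_mul2l IH orbT.
Qed.

Lemma level_leq E u n w c : (c < n)%N -> (level E u n w <= c)%N = (w \in ball E u c).
Proof.
move=> cn; rewrite /level; apply/idP/idP => [|wB].
  apply: contraLR => wB; rewrite -ltnNge.
  rewrite -[c.+1]card_ord -sum1_card.
  rewrite (big_ord_widen_cond n predT (fun=> 1%N)) // big_mkcond /=.
  apply: leq_sum => i _; case: ifP => // ic.
  by rewrite (contra _ wB) //; apply: (subsetP (ball_mono _ _ _)).
rewrite -[X in (_ <= X)%N]card_ord -sum1_card.
rewrite (big_ord_widen_cond n predT (fun=> 1%N)) ?(ltnW cn) // [leqRHS]big_mkcond /=.
apply: leq_sum => i _; case: ifP => [_|ic]; first exact: leq_b1.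
by rewrite (subsetP (ball_mono E u _) _ wB) // leqNgt ic.
Qed.

Lemma level_max E u n w : (level E u n w <= n)%N.
Proof.
rewrite /level -[X in (_ <= X)%N]card_ord -sum1_card.
by apply: leq_sum => i _; exact: leq_b1.
Qed.

Lemma level_adjacent E u n b w :
  adjacent E b w -> (level E u n w <= level E u n b + 1)%N.
Proof.
move=> adj; set l := level E u n b; rewrite addn1.
have [ln|nl] := ltnP l.+1 n; last exact: leq_trans (level_max _ _ _ _) nl.
by rewrite level_leq // (adjacent_ball adj) // -(level_leq _ _ _ (ltnW ln)).
Qed.

Lemma level_lipschitz E u n : lipschitz fst snd (level E u n) E.
Proof.
move=> [b w] bw; split; apply: level_adjacent; rewrite /adjacent /= bw ?orbT //.
Qed.

(** If [w] lay outside this ball, each of the [#|A|.+1] sublevel sets of the distance from [u] would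
    separate [u] from [w]. Edges of [A] would cross all of these levels, so by [crossing_rank] the
    rank of [A] would exceed its size. *)
Lemma span_ball (F : fieldType) E (A : {set 'I_v * 'I_v}) u w : A \subset E ->
  (evec F fst snd (u, w) <= spanf (evec F fst snd) A)%MS -> w \in ball E u #|A|.
Proof.
move=> sAE uwA; apply: contraT => wB; set n := #|A|.+1.
suff : (n <= rkf (evec F fst snd) A)%N.
  by rewrite leqNgt ltnS rkf_card.
apply: (@crossing_rank _ _ _ _ _ (level E u n) _ 0).
  by move=> x xA; apply: level_lipschitz (subsetP sAE _ xA).
move=> c; rewrite add0n => /andP[_ cn].
apply: (cross_exists (S := fun z => level E u n z <= c)%N uwA).
rewrite evec_ind /= !level_leq //.
have -> : (w \in ball E u c) = false.
  by apply: contraNF wB; apply: (subsetP (ball_mono _ _ _)); rewrite -ltnS.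
by rewrite center_ball subr0 oner_eq0.
Qed.

End Balls.

(* An edge-maximal graph of maximum degree at most 10 and girth at least [g]
   works: two vertices of smaller degree must be at distance less than [g], so
   all but boundedly many vertices have degree 10. *)
Lemma dense_girth_graph (F : fieldType) g : (0 < g)%N ->
  exists (v : nat) (E : {set 'I_v * 'I_v}),
    [/\ forall u, (#|incident E u| <= 10)%N,
        forall A : {set 'I_v * 'I_v}, A \subset E -> (#|A| < g)%N ->
          rkf (evec F fst snd) A = #|A|
      & (4 * v < #|E|)%N].
Proof.
(* [b] bounds a ball of radius [g] when degrees are at most 10. At most [b] vertices will have
   degree below 10, which leaves at least 5 (v - b) = 20 b + 5 edges against 4 v = 20 b + 4. *)
move=> g0; pose b := (11 ^ g)%N; pose v := (5 * b + 1)%N; exists v.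
pose rk := rkf (evec F (@fst 'I_v 'I_v) (@snd 'I_v 'I_v)).
pose P (E : {set 'I_v * 'I_v}) := [forall u, #|incident E u| <= 10]%N &&
  [forall A : {set 'I_v * 'I_v}, (A \subset E) && (#|A| < g)%N ==> (rk A == #|A|)].
have P0 : P set0.
  apply/andP; split; apply/forallP => x.
    by rewrite (_ : incident _ _ = set0) ?cards0 //; apply/setP => y; rewrite !inE.
  apply/implyP => /andP[]; rewrite subset0 => /eqP-> _.
  by rewrite eqn_leq rkf_card cards0.
have [E /maxsetP[/andP[/forallP dE /forallP gE] maxE] _] := maxset_exists P0.
have girth (A : {set 'I_v * 'I_v}) : A \subset E -> (#|A| < g)%N -> rk A = #|A|.
  by move=> sA cA; apply/eqP; have /implyP := gE A; apply; rewrite sA.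
exists E; split=> //.
pose low := [set u | #|incident E u| < 10]%N.
have lowP u w : u \in low -> w \in low -> w \in ball E u g.
  rewrite !inE => ul wl; have [->|ne] := eqVneq w u; first exact: center_ball.
  have [uwE|uwE] := boolP ((u, w) \in E).
    apply: (subsetP (ball_mono E u g0)); apply: (@adjacent_ball _ _ _ _ u).
      by rewrite /adjacent uwE.
    exact: center_ball.
  pose E' := (u, w) |: E.
  have nP : ~~ P E'.
    apply/negP => /maxE /(_ (subsetUr _ _)) eE.
    by move: uwE; rewrite -eE setU11.
  have dE' : [forall z, #|incident E' z| <= 10]%N.
    apply/forallP => z.
    have sub : incident E' z \subset (u, w) |: incident E z.
      by apply/subsetP => x; rewrite !inE; case: eqP.
    have [zu|zu] := boolP ((z == u) || (z == w)).
      apply: leq_trans (subset_leq_card sub) _; rewrite cardsU1.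
      have zl : (#|incident E z| < 10)%N by case/orP: zu => /eqP->.
      by apply: leq_trans (leq_add (leq_b1 _) (leqnn _)) _; rewrite add1n.
    rewrite (_ : incident E' z = incident E z) //; apply/setP => x; rewrite !inE.
    case: eqP => //= ->; rewrite (negPf uwE) /=; move: zu.
    by rewrite negb_or !(eq_sym z) => /andP[/negPf-> /negPf->].
  move: nP; rewrite /P dE' /= => /forallPn[A]; rewrite negb_imply => /andP[/andP[sA cA] /eqP rA].
  have uwA : (u, w) \in A.
    apply: contraT => uwA; case: rA; apply: girth => //.
    apply/subsetP => x xA; have := subsetP sA x xA; rewrite in_setU1 => /predU1P[xe|//].
    by rewrite -xe xA in uwA.
  pose A' := A :\ (u, w).
  have sA' : A' \subset E.
    apply/subsetP => x; rewrite !inE => /andP[xn /(subsetP sA)].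
    by rewrite in_setU1 (negPf xn).
  have cA' : (#|A'| < #|A|)%N by rewrite (cardsD1 (u, w) A) uwA.
  have := @rkf_dep_mem F _ v (evec F fst snd) (u, w) A'.
  rewrite setD1K // !inE eqxx /= => /(_ isT (girth _ sA' (ltn_trans cA' cA)) rA).
  move/(span_ball sA'); apply: (subsetP (ball_mono _ _ _)).
  exact: leq_trans (ltnW cA') (ltnW cA).
have clow : (#|low| <= b)%N.
  have [->|[u ul]] := set_0Vmem low; first by rewrite cards0.
  apply: leq_trans (subset_leq_card _) (card_ball u g dE).
  by apply/subsetP => w; apply: lowP.
have hs : (\sum_u #|incident E u| <= 2 * #|E|)%N.
  under eq_bigr => u _ do rewrite -sum1_card big_mkcond /=.
  rewrite exchange_big /= -sum1_card big_distrr /= [leqRHS]big_mkcond /=.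
  apply: leq_sum => x _; rewrite muln1; case xE: (x \in E); last first.
    by rewrite big1 // => u _; rewrite inE xE.
  rewrite (bigD1 x.1) //= !inE xE eqxx /=.
  rewrite (leq_add2l 1 _ 1) -big_mkcondr /= sum1_card.
  rewrite -(cards1 x.2); apply: subset_leq_card; apply/subsetP => u.
  by rewrite unfold_in !inE xE /= eq_sym => /andP[/negPf->] /=; rewrite eq_sym.
have hl : (10 * (v - b) <= \sum_u #|incident E u|)%N.
  apply: leq_trans (_ : (\sum_(u in ~: low) 10 <= _)%N).
    have := cardsC low; rewrite sum_nat_const card_ord; lia.
  rewrite [leqRHS](bigID (mem (~: low))) /=; apply: leq_trans (leq_addr _ _).
  by apply: leq_sum => u; rewrite !inE -leqNgt.
rewrite /v in hl hs *; lia.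
Qed.

Lemma subset_card_eq (T : finType) (A : {set T}) n : (n <= #|A|)%N ->
  exists2 B : {set T}, B \subset A & #|B| = n.
Proof.
move=> nA; exists [set x in take n (enum A)].
  by apply/subsetP => x; rewrite inE => /mem_take; rewrite mem_enum.
rewrite cardsE (card_uniqP _) ?take_uniq ?enum_uniq //.
by rewrite size_takel // -cardE.
Qed.

(** A dependent subset has more than [g] elements, and any [g] of these are independent. *)
Lemma girth_rank (F : fieldType) (T : finType) v (f : T -> 'rV[F]_v) (E : {set T}) g :
  (forall A : {set T}, A \subset E -> (#|A| <= g)%N -> rkf f A = #|A|) ->
  forall A : {set T}, A \subset E -> rkf f A <> #|A| -> (g <= rkf f A)%N.
Proof.
move=> girth A sA dA; have [cA|cA] := leqP #|A| g; first by case: dA; apply: girth.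
have [B sB cB] := subset_card_eq (ltnW cA).
by rewrite -cB -girth ?cB ?(subset_trans sB) // rkfS.
Qed.

(** No edge leaves [B], so the two edge sets use disjoint sets of coordinates: the projection [Z] to
    the coordinates in [B] fixes one span and kills the other. *)
Lemma closed_ball_rank (F : fieldType) v (E : {set 'I_v * 'I_v}) (B : {set 'I_v}) :
  (forall x, x \in E -> (x.1 \in B) = (x.2 \in B)) ->
  let f := evec F fst snd in let A := [set x in E | x.1 \in B] in
  (rkf f A <= #|B|)%N /\ (rkf f A + rkf f (E :\: A) <= rkf f E)%N.
Proof.
move=> cl f A; split.
  apply: leq_trans (rkf_card (fun u => delta_mx 0 u : 'rV[F]_v) B).
  apply: mxrankS; apply/spanf_subP => x; rewrite inE => /andP[xE xB].
  by rewrite /f /evec addmx_sub ?eqmx_opp ?spanf_mem -?cl.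
pose Z : 'M[F]_v := diag_mx (\row_u (u \in B)%:R).
have dZ u : delta_mx 0 u *m Z = (u \in B)%:R *: delta_mx 0 u :> 'rV_v.
  apply/rowP => w; rewrite mul_mx_diag !mxE eqxx /=.
  by case: eqP => [->|]; rewrite ?mul1r ?mulr1 ?mul0r ?mulr0.
have ZA : (spanf f A <= kermx (Z - 1%:M))%MS.
  apply/spanf_subP => x; rewrite inE => /andP[xE xB]; apply/sub_kermxP.
  by rewrite mulmxBr mulmx1 mulmxBl !dZ -cl // xB !scale1r subrr.
have ZR : (spanf f (E :\: A) <= kermx Z)%MS.
  apply/spanf_subP => x; rewrite !inE andbC negb_and.
  case xE: (x \in E) => //= xB; apply/sub_kermxP.
  by rewrite mulmxBl !dZ -cl // (negPf xB) !scale0r subrr.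
have cap0 : (spanf f A :&: spanf f (E :\: A))%MS = 0.
  set U := (_ :&: _)%MS.
  have /sub_kermxP UA : (U <= kermx (Z - 1%:M))%MS by apply: submx_trans ZA; apply: capmxSl.
  have /sub_kermxP UR : (U <= kermx Z)%MS by apply: submx_trans ZR; apply: capmxSr.
  move: UA; rewrite mulmxBr UR mulmx1 sub0r => /eqP.
  by rewrite oppr_eq0 => /eqP.
rewrite /rkf -mxrank_disjoint_sum //; apply: mxrankS.
by rewrite addsmx_sub !spanfS ?subsetDl //; apply/subsetP => x; rewrite inE => /andP[].
Qed.

(** The hypotheses place [w] at distance exactly [c], and the construction follows a shortest path
    back to [u]. The guards [0 < c] and [0 < i] are there because [0.-1] is 0. *)
Lemma ball_path v (E : {set 'I_v * 'I_v}) u c w :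
  w \in ball E u c -> ((0 < c)%N -> w \notin ball E u c.-1) ->
  exists (vs : nat -> 'I_v) (ps : nat -> 'I_v * 'I_v),
    [/\ vs c = w,
        forall i, (i < c)%N -> ps i \in E /\
          (ps i = (vs i, vs i.+1) \/ ps i = (vs i.+1, vs i))
      & forall i, (i <= c)%N ->
          vs i \in ball E u i /\ ((0 < i)%N -> vs i \notin ball E u i.-1)].
Proof.
elim: c w => [|c IH] w wB wnB.
  exists (fun=> w), (fun=> (w, w)); split=> // i.
  by rewrite leqn0 => /eqP->; split.
have /= {}wnB := wnB isT.
move: (wB); rewrite ballS inE (negPf wnB) /= inE => /existsP[b /andP[bB adj]].
have bnB : (0 < c)%N -> b \notin ball E u c.-1.
  move=> c0; apply: contra wnB => /(adjacent_ball adj); by rewrite prednK.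
have [vs [ps [vsc hp hb]]] := IH b bB bnB.
pose p := if (b, w) \in E then (b, w) else (w, b).
exists (fun i => if i == c.+1 then w else vs i), (fun i => if i == c then p else ps i).
split; first by rewrite eqxx.
  move=> i; rewrite ltnS leq_eqVlt => /predU1P[->|ic].
    rewrite !eqxx ltn_eqF ?ltnS // vsc; rewrite /p.
    by case: ifP adj; rewrite /adjacent => -> //=; split=> //; [left | right].
  by rewrite !ltn_eqF ?ltnS //; [apply: hp | apply: ltnW].
move=> i; rewrite leq_eqVlt => /predU1P[->|]; first by rewrite eqxx; split.
by rewrite ltnS => ic; rewrite ltn_eqF ?ltnS //; apply: hb.
Qed.

Lemma rkf_reindex (F : fieldType) (T I : finType) v (f : T -> 'rV[F]_v) (h : I -> T)
    (A : {set I}) : injective h -> rkf f (h @: A) = rkf (f \o h) A.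
Proof. by move=> ih; rewrite /rkf /spanf big_imset //= => x y _ _ /ih. Qed.

(* Terms elaborated through different canonical paths differ by
   [reverse_coercion], which hides equal atoms from [lia]. *)
Ltac rlia :=
  try unfold reverse_coercion;
  repeat match goal with
  | H : is_true _ |- _ => progress unfold reverse_coercion in H
  | H : _ = _ |- _ => progress unfold reverse_coercion in H
  | H : _ <> _ |- _ => progress unfold reverse_coercion in H
  end; lia.

(* A set of edges that is minimal for [4 * rank < size + 4 * kappa] has no
   separation of order below [kappa] into two sides of large rank, because both
   sides violate the inequality. *)
Lemma linked_girth_graph (F : fieldType) kappa rho N e0 :
  (0 < kappa)%N -> (2 * kappa <= rho)%N ->
  exists (v e : nat) (s t : 'I_e -> 'I_v) (phi : 'I_v -> nat)
         (vs : nat -> 'I_v) (ps : nat -> 'I_e),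
    let rk := rkf (evec F s t) in
    [/\ (forall A : {set 'I_e}, (#|A| <= rho)%N -> rk A = #|A|),
        (forall A B : {set 'I_e}, A :|: B = [set: 'I_e] -> A :&: B = set0 ->
           (rho <= rk A)%N -> (rho <= rk B)%N -> (rk [set: 'I_e] + kappa <= rk A + rk B)%N),
        lipschitz s t phi [set: 'I_e],
        (forall c, (c < N)%N ->
           (s (ps c) = vs c /\ t (ps c) = vs c.+1) \/
           (s (ps c) = vs c.+1 /\ t (ps c) = vs c)) /\
        (forall c, (c <= N)%N -> phi (vs c) = c)
      & (4 * rk [set: 'I_e] <= e + 4 * kappa)%N /\ (e0 <= e)%N].
Proof.
(* Each summand has its own use: 11 ^ N bounds the balls of radius below [N], which must keep
   growing; [rho] serves the girth and rank conditions; [e0] bounds the number of edges from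
   below. *)
move=> k0 k2; pose g := (11 ^ N + rho + e0 + 1)%N.
have [|v [E0 [deg0 girth0 dens]]] := @dense_girth_graph F g.+1; first by [].
pose f := evec F (@fst 'I_v 'I_v) (@snd 'I_v 'I_v).
have girth (A : {set 'I_v * 'I_v}) : A \subset E0 -> (#|A| <= g)%N -> rkf f A = #|A|.
  by move=> sA cA; apply: girth0.
have dep := girth_rank girth.
pose P (E : {set 'I_v * 'I_v}) := [&& E \subset E0, rho <= rkf f E & 4 * rkf f E < #|E| + 4 * kappa]%N.
have P0 : P E0.
  have r0 : (rkf f E0 <= v)%N by apply: rank_leq_col.
  apply/and3P; split=> //; last by rlia.
  apply: leq_trans (dep _ (subxx _) _); last by rlia.
  by rewrite /g; rlia.
have [E /minsetP[/and3P[sE rE dE] minE] _] := minset_exists P0.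
have ndE : rkf f E <> #|E| by rlia.
have rgE := dep E sE ndE.
have proper (A : {set 'I_v * 'I_v}) : A \proper E -> (rho <= rkf f A)%N ->
    (#|A| + 4 * kappa <= 4 * rkf f A)%N.
  move=> pA rA; rewrite leqNgt; apply/negP => dA.
  have sA := proper_sub pA.
  have /minE /(_ sA) eA : P A by rewrite /P (subset_trans sA sE) rA.
  by move: pA; rewrite eA properxx.
have cE : (g < #|E|)%N by have := rkf_card f E; rlia.
have [x0 x0E] : exists x, x \in E by apply/set0Pn; rewrite -card_gt0; rlia.
pose u := x0.1.
have degE w : (#|incident E w| <= 10)%N.
  apply: leq_trans (deg0 w); apply: subset_leq_card; apply/subsetP => x.
  by rewrite !inE => /andP[/(subsetP sE)-> ->].
(* Were the ball closed, its edges [A] would form a union of components of rank at most 11 ^ N. The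
   rest [R] still has rank at least [rho], so minimality bounds its size and leaves [A] with more
   than four times as many edges as its rank. Then [A] is dependent, and its rank is at least [g]: a
   contradiction. *)
have grow c : (c < N)%N -> ball E u c.+1 != ball E u c.
  move=> cN; apply/eqP => eB; set B := ball E u c in eB.
  have cB : (#|B| <= 11 ^ N)%N.
    by apply: leq_trans (card_ball u c degE) _; rewrite leq_exp2l // ltnW.
  have cl x : x \in E -> (x.1 \in B) = (x.2 \in B).
    move=> xE; have ad : adjacent E x.1 x.2 by rewrite /adjacent -surjective_pairing xE.
    apply/idP/idP => h; rewrite -eB; first exact: adjacent_ball ad h.
    by apply: adjacent_ball h; rewrite adjacent_sym.
  have /= := closed_ball_rank F cl; rewrite -/f; set A := [set x in E | _].
  case=> /leq_trans /(_ cB) rA rS; set R := E :\: A in rS.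
  have x0A : x0 \in A by rewrite inE x0E center_ball.
  have sAE : A \subset E by apply/subsetP => x; rewrite inE => /andP[].
  have pR : R \proper E.
    by apply/properP; split; [apply: subsetDl | exists x0 => //; rewrite inE x0A].
  have rU := rkfU f A R.
  have eU : A :|: R = E by rewrite -{1}(setIidPr sAE) setID.
  rewrite eU in rU.
  have rR : (rho <= rkf f R)%N by move: rgE; rewrite /g; rlia.
  have := proper _ pR rR; have := cardsID A E; rewrite (setIidPr sAE) -/R => cAR hR.
  have A0 : (0 < #|A|)%N by apply/card_gt0P; exists x0.
  have ndA : rkf f A <> #|A| by rlia.
  have := dep A (subset_trans sAE sE) ndA; rewrite /g; rlia.
have [w wB wnB] : exists2 w, w \in ball E u N & ((0 < N)%N -> w \notin ball E u N.-1).
  have [N0|N0] := posnP N; first by exists u; rewrite ?N0 // center_ball.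
  have := grow N.-1; rewrite prednK // leqnn => /(_ isT).
  rewrite eqEsubset (ball_mono E u (leq_pred N)) andbT.
  by case/subsetPn => w wB wnB; exists w.
have [vs [ps [_ hp hb]]] := ball_path wB wnB.
pose h (i : 'I_#|E|) := enum_val i.
have ih : injective h by apply: enum_val_inj.
have hE i : h i \in E by apply: enum_valP.
pose s i := (h i).1; pose t i := (h i).2.
have rkE A : rkf (evec F s t) A = rkf f (h @: A) by rewrite (rkf_reindex f A ih).
have imT : h @: [set: 'I_#|E|] = E.
  apply/setP => x; apply/imsetP/idP => [[i _ ->]|xE]; first exact: hE.
  by exists (enum_rank_in xE x); rewrite ?inE // /h enum_rankK_in.
have imS (A : {set 'I_#|E|}) : h @: A \subset E.
  by apply/subsetP => x /imsetP[i _ ->]; apply: hE.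
(* Truncating the distance at [N.+1] keeps the levels 0 to [N] exact. *)
exists v, #|E|, s, t, (level E u N.+1), vs, (fun c => enum_rank_in x0E (ps c)).
move=> rk; split.
- move=> A cA; rewrite /rk rkE girth ?(subset_trans (imS A)) // card_imset //.
  by apply: leq_trans cA _; rewrite /g; rlia.
- move=> A B uAB iAB rA rB; rewrite /rk !rkE imT in rA rB *.
  have cAB : (#|h @: A| + #|h @: B| = #|E|)%N.
    rewrite !card_imset // -cardsUI iAB cards0 addn0 uAB cardsT card_ord //.
  have prop (C D : {set 'I_#|E|}) : C :&: D = set0 -> (rho <= rkf f (h @: D))%N -> h @: C \proper E.
    move=> iCD rD; rewrite properEneq imS andbT; apply/eqP => eC.
    have [D0|[i iD]] := set_0Vmem D.
      by have := rkf_card f (h @: D); rewrite D0 imset0 cards0; move: rD; rewrite D0 imset0; rlia.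
    have : h i \in h @: C by rewrite eC.
    case/imsetP => j jC /ih eij; have : i \in C :&: D by rewrite inE iD eij jC.
    by rewrite iCD inE.
  have h1 := proper _ (prop A B iAB rB) rA.
  have h2 := proper _ (prop B A (etrans (setIC _ _) iAB) rA) rB.
  rlia.
- by move=> i _; apply: level_lipschitz.
- split=> c cN.
    have [pE] := hp c cN; rewrite /s /t /h enum_rankK_in //.
    by case=> ->; [left | right].
  have [vB vnB] := hb c cN; apply/eqP; rewrite eqn_leq level_leq ?ltnS // vB /=.
  case: c cN {vB} vnB => // c cN /(_ isT) /=.
  by rewrite -(@level_leq _ E u N.+1) -?ltnNge // ltnW // ltnS.
- rewrite /rk rkE imT; split; first by rlia.
  by move: cE; rewrite /g; rlia.
Qed.

(** * The non-Fano configuration *)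

Definition nonfano : seq (seq int) :=
  [:: [:: 1; 0; 0]; [:: 0; 1; 0]; [:: 0; 0; 1];
      [:: 1; 1; 1]; [:: 1; 1; -1]; [:: 1; -1; 1]; [:: 1; -1; -1]].

Definition nf (l a : nat) : int := nth 0 (nth [::] nonfano l) a.

Definition dot3 (z w : nat -> int) : int := z 0 * w 0 + z 1 * w 1 + z 2 * w 2.

Definition comb (c : nat -> int) (a : nat) : int :=
  c 0 * nf 0 a + c 1 * nf 1 a + c 2 * nf 2 a + c 3 * nf 3 a + c 4 * nf 4 a
  + c 5 * nf 5 a + c 6 * nf 6 a.

Fixpoint words (T : Type) (alphabet : seq T) n : seq (seq T) :=
  if n is n'.+1 then flatten [seq [seq x :: w | w <- words alphabet n'] | x <- alphabet]
  else [:: [::]].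

Lemma mem_words (T : eqType) (alphabet : seq T) w :
  {subset w <= alphabet} -> w \in words alphabet (size w).
Proof.
elim: w => [|x w IH] //= sub; apply/flatten_mapP; exists x; first by apply: sub; rewrite inE eqxx.
by apply: map_f; apply: IH => y yw; apply: sub; rewrite inE yw orbT.
Qed.

(* Every flat of the configuration is cut out by some of these. *)
Definition short_functionals : seq (seq int) :=
  [:: [:: 1; 0; 0]; [:: 0; 1; 0]; [:: 0; 0; 1];
      [:: 1; 1; 0]; [:: 1; -1; 0]; [:: 1; 0; 1]; [:: 1; 0; -1];
      [:: 0; 1; 1]; [:: 0; 1; -1]].

Definition supported (J : seq bool) (c : seq int) : bool :=
  all (fun l => (c`_l == 0) || nth false J l) (iota 0 7).

Definition kills (z : seq int) (J : seq bool) : bool :=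
  all (fun l => nth false J l ==> (dot3 (nth 0 z) (nf l) == 0)) (iota 0 7).

(** The bound [b] on the number of nonzero letters keeps the search small; 3 is enough later because
    the configuration has rank 3. *)
Fixpoint sparse_words n b : seq (seq int) :=
  if n is n'.+1 then
    [seq 0 :: w | w <- sparse_words n' b] ++
    (if b is b'.+1 then
       flatten [seq [seq x :: w | w <- sparse_words n' b'] | x <- [:: 1; -1; 2; -2; 4; -4]]
     else [::])
  else [:: [::]].

(** The vector is doubled because expressing it may need halves, which exist in every field where 2
    is nonzero. *)
Definition doubles (w : seq int) : seq (seq int) :=
  [seq c <- sparse_words 7 3 | all (fun a => comb (nth 0 c) a == 2 * w`_a) (iota 0 3)].

(** The finite fact behind [local_span]: for vectors with entries 0, 1, -1, the short equations
    satisfied by a set [J] of points decide membership in its span. The coefficients found are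
    integers up to a factor 2, so one computation serves all fields of characteristic different from
    2. *)
Definition span_check : bool :=
  all (fun w => let g := doubles w in
    all (fun J => all (fun z => kills z J ==> (dot3 (nth 0 z) (nth 0 w) == 0)) short_functionals
                  ==> has (supported J) g) (words [:: true; false] 7))
    (words [:: 0; 1; -1 : int] 3).

Lemma span_checkP : span_check.
Proof. by vm_compute. Qed.

(* The six triangles and the eleven four-element circuits. *)
Definition circuits : seq (seq int) :=
  [:: [:: 2; 0; 0; -1; 0; 0; -1];
      [:: 2; 0; 0; 0; -1; -1; 0];
      [:: 0; 2; 0; -1; 0; 1; 0];
      [:: 0; 2; 0; 0; -1; 0; 1];
      [:: 0; 0; 2; -1; 1; 0; 0];
      [:: 0; 0; 2; 0; 0; -1; 1];
      [:: 1; 1; 1; -1; 0; 0; 0];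
      [:: 1; 1; -1; 0; -1; 0; 0];
      [:: 1; -1; 1; 0; 0; -1; 0];
      [:: 1; -1; -1; 0; 0; 0; -1];
      [:: 2; 2; 0; -1; -1; 0; 0];
      [:: 2; -2; 0; 0; 0; -1; -1];
      [:: 2; 0; 2; -1; 0; -1; 0];
      [:: 2; 0; -2; 0; -1; 0; -1];
      [:: 0; 2; 2; -1; 0; 0; 1];
      [:: 0; 2; -2; 0; -1; 1; 0];
      [:: 0; 0; 0; 1; -1; -1; 1]].

(** A set [J] containing no listed circuit is independent because each of its points is isolated
    from the others by a short functional; the values 1, -1, 2, -2 stay nonzero wherever 2 does. *)
Definition circuit_check : bool :=
  all (fun J =>
    has (fun c => supported J c) circuits ||
    all (fun l => nth false J l ==>
      has (fun z => kills z (set_nth false J l false) &&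
                    (dot3 (nth 0 z) (nf l) \in [:: 1; -1; 2; -2])) short_functionals)
      (iota 0 7)) (words [:: true; false] 7).

Lemma circuit_checkP : circuit_check.
Proof. by vm_compute. Qed.

Lemma circuits_comb : all (fun c => all (fun a => comb (nth 0 c) a == 0) (iota 0 3)) circuits.
Proof. by []. Qed.

Lemma circuits_coef :
  all (fun c : seq int => has (fun l => (c`_l == 1) || (c`_l == 2)) (iota 0 7)) circuits.
Proof. by []. Qed.

(** * Transport of relations in one configuration between fields *)

Section Transport.
Variables F F2 : fieldType.
Hypotheses (h2 : (2 : F) != 0) (h2' : (2 : F2) != 0).

Definition combf (K : fieldType) (y : nat -> K) (a : nat) : K :=
  y 0 * (nf 0 a)%:~R + y 1 * (nf 1 a)%:~R + y 2 * (nf 2 a)%:~R + y 3 * (nf 3 a)%:~R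
  + y 4 * (nf 4 a)%:~R + y 5 * (nf 5 a)%:~R + y 6 * (nf 6 a)%:~R.

(* An odd function selecting the value [c]: odd functions transport solutions
   of the equations [x = y], [x = - y] and [x = 0] from one field to another. *)
Definition select (c x : F) : int := if x == c then 1 else if x == - c then -1 else 0.

Lemma eq_oppF (x : F) : (x == - x) = (x == 0).
Proof. by rewrite -addr_eq0 -mulr2n -mulr_natl mulf_eq0 (negPf h2). Qed.

Lemma select0 c : c != 0 -> select c 0 = 0.
Proof. by move=> c0; rewrite /select ![0 == _]eq_sym oppr_eq0 (negPf c0). Qed.

Lemma selectN c x : c != 0 -> select c (- x) = - select c x.
Proof.
move=> c0; rewrite /select eqr_oppLR eqr_opp.
have [->|xc] := eqVneq x (- c); first by rewrite eq_sym eq_oppF (negPf c0).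
by case: eqP.
Qed.

Lemma combf_int (c : nat -> int) a : combf (fun l => (c l)%:~R : F2) a = (comb c a)%:~R.
Proof. by rewrite /combf /comb !rmorphD !rmorphM. Qed.

Lemma dot_combf (z : nat -> int) (y : nat -> F) :
  (z 0)%:~R * combf y 0 + (z 1)%:~R * combf y 1 + (z 2)%:~R * combf y 2 =
  y 0 * (dot3 z (nf 0))%:~R + y 1 * (dot3 z (nf 1))%:~R + y 2 * (dot3 z (nf 2))%:~R
  + y 3 * (dot3 z (nf 3))%:~R + y 4 * (dot3 z (nf 4))%:~R + y 5 * (dot3 z (nf 5))%:~R
  + y 6 * (dot3 z (nf 6))%:~R.
Proof.
rewrite /combf /dot3; move: nf => p; rewrite !rmorphD !rmorphM /=; ring.
Qed.

Lemma kills_dot (J : seq bool) (y : nat -> F) z :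
  (forall l, (l < 7)%N -> y l != 0 -> nth false J l) -> kills z J ->
  (z`_0)%:~R * combf y 0 + (z`_1)%:~R * combf y 1 + (z`_2)%:~R * combf y 2 = 0.
Proof.
move=> sy /allP kz.
have E l : (l < 7)%N -> y l * (dot3 (nth 0 z) (nf l))%:~R = 0.
  move=> l7; have [->|yl] := eqVneq (y l) 0; first by rewrite mul0r.
  have /(_ l) := kz; rewrite mem_iota l7 (sy l l7 yl) => /(_ isT) /eqP->.
  by rewrite mulr0.
by rewrite (dot_combf (nth 0 z)) !E // !addr0.
Qed.

(** Because [select c] is odd, the selected values satisfy every short equation that the original
    vector satisfies, and [span_checkP] puts them in the span of the same points. *)
Lemma local_span (J : seq bool) (y : nat -> F) c : size J = 7%N -> c != 0 ->
  (forall l, (l < 7)%N -> y l != 0 -> nth false J l) ->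
  exists y2 : nat -> F2, (forall l, (l < 7)%N -> y2 l != 0 -> nth false J l) /\
    (forall a, (a < 3)%N -> combf y2 a = (select c (combf y a))%:~R).
Proof.
move=> sJ c0 sy; pose w := [:: select c (combf y 0); select c (combf y 1); select c (combf y 2)].
have wA : w \in words [:: 0; 1; -1] 3.
  apply: (@mem_words _ _ w) => x; rewrite !inE /select.
  by case/or3P => /eqP->; case: ifP => // _; case: ifP.
have JA : J \in words [:: true; false] 7.
  by rewrite -sJ; apply: mem_words => -[]; rewrite !inE.
have /allP/(_ w wA)/allP/(_ J JA)/implyP chk := span_checkP.
have /chk/hasP[d] :
    all (fun z => kills z J ==> (dot3 (nth 0 z) (nth 0 w) == 0)) short_functionals.
  apply/allP => z zA; apply/implyP => /(kills_dot sy).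
  have op x x' : x + x' = 0 -> select c x + select c x' = 0.
    by move/eqP; rewrite addr_eq0 => /eqP->; rewrite selectN // addNr.
  have om x x' : x - x' = 0 -> select c x - select c x' = 0.
    by move/eqP; rewrite subr_eq0 => /eqP->; rewrite subrr.
  have o0 x : x = 0 -> select c x = 0 by move->; apply: select0.
  move: zA; rewrite /short_functionals /dot3 !inE.
  do 8?[case/orP]; move/eqP-> => /=;
    rewrite ?mulN1r ?mulrN1z ?mulN1r ?mul1r ?mul0r ?addr0 ?add0r => h; apply/eqP;
    by [exact: op | exact: om | exact: o0].
rewrite mem_filter => /andP[/allP eqd _] sd.
exists (fun l => (d`_l)%:~R / 2); split=> [l l7|a a3].
  move: sd => /allP/(_ l); rewrite mem_iota l7 => /(_ isT) /orP[/eqP->|//].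
  by rewrite mul0r eqxx.
have := eqd a; rewrite mem_iota a3 => /(_ isT)/eqP E.
have -> : combf (fun l => (d`_l)%:~R / 2 : F2) a = combf (fun l => (d`_l)%:~R) a / 2.
  rewrite /combf; ring.
rewrite (combf_int (nth 0 d)) E rmorphM /= mulrC mulKf //.
by case: a a3 {E} => [|[|[|]]].
Qed.

(** If [J] contains a listed circuit, its integer coefficients work in every field. Otherwise
    applying a functional that isolates [l0] to the vanishing combination would give [y l0 = 0]. *)
Lemma local_dep (J : seq bool) (y : nat -> F) l0 : size J = 7%N -> (l0 < 7)%N -> y l0 != 0 ->
  (forall l, (l < 7)%N -> y l != 0 -> nth false J l) ->
  (forall a, (a < 3)%N -> combf y a = 0) ->
  exists y2 : nat -> F2, [/\ forall l, (l < 7)%N -> y2 l != 0 -> nth false J l,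
    exists2 l, (l < 7)%N & y2 l != 0 & forall a, (a < 3)%N -> combf y2 a = 0].
Proof.
move=> sJ l07 yl0 sy w0.
have JA : J \in words [:: true; false] 7.
  by rewrite -sJ; apply: mem_words => -[]; rewrite !inE.
have /allP/(_ J JA)/orP[/hasP[d dA sd]|/allP/(_ l0)] := circuit_checkP.
  exists (fun l => (d`_l)%:~R); split.
  - move=> l l7 dl; move: sd => /allP/(_ l); rewrite mem_iota l7 => /(_ isT).
    by case/orP => // /eqP d0; rewrite d0 eqxx in dl.
  - have /allP/(_ d dA)/hasP[l] := circuits_coef; rewrite mem_iota => l7 dl.
    by exists l => //; case/orP: dl => /eqP->; rewrite ?oner_eq0 // -[2%:~R]/(2 : F2).
  - move=> a a3; rewrite (combf_int (nth 0 d)).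
    by have /allP/(_ d dA)/allP/(_ a) := circuits_comb; rewrite mem_iota a3 => /(_ isT)/eqP->.
rewrite mem_iota l07 => /(_ isT); rewrite (sy _ l07 yl0) implyTb => /hasP[z _ /andP[/allP kz dz]].
have E l : (l < 7)%N -> l != l0 -> y l * (dot3 (nth 0 z) (nf l))%:~R = 0.
  move=> l7 ll0; have [->|yl] := eqVneq (y l) 0; first by rewrite mul0r.
  have := kz l; rewrite mem_iota l7 => /(_ isT); rewrite nth_set_nth /= (negPf ll0).
  by rewrite (sy l l7 yl) => /eqP->; rewrite mulr0.
have: y l0 * (dot3 (nth 0 z) (nf l0))%:~R = 0.
  have [T ET] : exists T, y l0 * (dot3 (nth 0 z) (nf l0))%:~R = T by eexists.
  have E' l : (l < 7)%N ->
      y l * (dot3 (nth 0 z) (nf l))%:~R = if l == l0 then T else 0.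
    by move=> l7; case: eqP => [->//|/eqP]; apply: E.
  rewrite ET; have := dot_combf (nth 0 z) y; rewrite !w0 // !mulr0 !addr0 !E' //.
  have : l0 \in iota 0 7 by rewrite mem_iota.
  rewrite /= !inE; do 6?[case/orP]; move/eqP->;
  by rewrite /= ?add0r ?addr0.
have nz : ((dot3 (nth 0 z) (nf l0))%:~R : F) != 0.
  by move: dz; rewrite !inE => /or4P[] /eqP->; rewrite ?mulrNz ?oppr_eq0 ?oner_eq0.
by move/eqP; rewrite mulf_eq0 (negPf yl0) (negPf nz).
Qed.
End Transport.

(** * The matroid of a graph with gadgets *)

Lemma kermx_annihilator (F : fieldType) m n (A : 'M[F]_(m, n)) (y : 'cV[F]_m) :
  kermx A *m y = 0 -> exists x, y = A *m x.
Proof.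
move=> Ky.
have /eqmxP eqA : (A^T == kermx (kermx A)^T)%MS.
  have sA : (A^T <= kermx (kermx A)^T)%MS.
    by apply/sub_kermxP; rewrite -trmx_mul mulmx_ker trmx0.
  rewrite -(geq_leqif (mxrank_leqif_eq sA)) mxrank_ker !mxrank_tr mxrank_ker.
  by have := rank_leq_row A; lia.
have /submxP[x ex] : (y^T <= A^T)%MS.
  by rewrite eqA; apply/sub_kermxP; rewrite -trmx_mul Ky trmx0.
by exists x^T; rewrite -[y]trmxK ex trmx_mul trmxK.
Qed.

(** * Linear relations and independence in vector matroids *)

Section VectorMatroidIndependence.
Variables (F : fieldType) (m n : nat) (A : 'M[F]_(m, n)) (S : {set 'I_n}).

Let colsE : cols A S = A *m cols 1%:M S.
Proof. by rewrite /cols mulmx_colsub mulmx1. Qed.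

Let liftE (u : 'cV[F]_#|S|) k : (cols 1%:M S *m u) (enum_val k) 0 = u k 0.
Proof.
rewrite mxE (bigD1 k) //= big1 ?addr0 => [|k' nk]; first by rewrite !mxE eqxx mul1r.
by rewrite !mxE (inj_eq enum_val_inj) eq_sym (negPf nk) mul0r.
Qed.

Let liftN (u : 'cV[F]_#|S|) j : j \notin S -> (cols 1%:M S *m u) j 0 = 0.
Proof.
move=> jS; rewrite mxE big1 // => k _; rewrite !mxE; case: eqP => [ej|]; last by rewrite mul0r.
by rewrite ej enum_valP in jS.
Qed.

Lemma in_vindep_ker : (S \in vindep A) = (kermx (cols A S)^T == 0).
Proof. by rewrite inE -mxrank_tr -[_ == _]/(row_free _) -kermx_eq0. Qed.

Lemma vindep_relation0 (y : 'cV_n) : S \in vindep A ->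
  (forall j, j \notin S -> y j 0 = 0) -> A *m y = 0 -> y = 0.
Proof.
rewrite in_vindep_ker => /eqP k0 yS Ay.
have yE : y = cols 1%:M S *m (\col_k y (enum_val k) 0).
  apply/colP => j; have [jS|jS] := boolP (j \in S); last by rewrite liftN // yS.
  by rewrite -(enum_rankK_in jS jS) liftE mxE.
rewrite yE; set u := \col_k _ in yE *.
suff -> : u = 0 by rewrite mulmx0.
have : (u^T <= kermx (cols A S)^T)%MS.
  by apply/sub_kermxP; rewrite -trmx_mul colsE -mulmxA -yE Ay trmx0.
by rewrite k0 submx0 => /eqP/(congr1 trmx); rewrite trmxK trmx0.
Qed.

Lemma vindep_relation : S \notin vindep A -> exists y : 'cV_n,
  [/\ forall j, j \notin S -> y j 0 = 0, A *m y = 0 & exists j, y j 0 != 0].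
Proof.
rewrite in_vindep_ker => /rowV0Pn[r /sub_kermxP kr /rV0Pn[i ri]].
exists (cols 1%:M S *m r^T); split.
- by move=> j; apply: liftN.
- by rewrite mulmxA -colsE -[cols A S]trmxK -trmx_mul kr trmx0.
- by exists (enum_val i); rewrite liftE mxE.
Qed.

End VectorMatroidIndependence.

Section GadgetMatrix.
Variables (v e : nat) (s t : 'I_e -> 'I_v) (X : {set 'I_v}).
Variables (Gam : finType) (ge : Gam -> 'I_3 -> 'I_e).
Hypothesis ge_inj : forall g g' a a', ge g a = ge g' a' -> g = g' /\ a = a'.
Hypothesis ge_X : forall g a, (s (ge g a) \in X) || (t (ge g a) \in X).

Let nq := #|{: Gam * 'I_4}|.

(** The incidence matrix with the columns in [X] zeroed, so that its left kernel consists of the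
    flows conserved outside [X]. *)
Definition cutmx (F : fieldType) : 'M[F]_(e, v) :=
  \matrix_(i, u) ((u \notin X)%:R * ((s i == u)%:R - (t i == u)%:R)).

Definition qmx (F : fieldType) : 'M[F]_(e, nq) :=
  \matrix_(i, j) \sum_(a < 3) let p : Gam * 'I_4 := enum_val j in
    (ge p.1 a == i)%:R * (nf (3 + p.2) a)%:~R.

(* The row space consists of the flows on the graph that are conserved outside
   [X], each extended by the values of the four signed sums of every gadget. *)
Definition gadget_mx (F : fieldType) : 'M[F]_(e, e + nq) :=
  kermx (cutmx F) *m row_mx 1%:M (qmx F).

Definition elt (g : Gam) (l : nat) : 'I_(e + nq) :=
  if (l < 3)%N then lshift nq (ge g (inord l))
  else rshift e (enum_rank (g, inord (l - 3) : 'I_4)).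

Definition gadget_edge (i : 'I_e) := [exists g, exists a, ge g a == i].

Lemma gadget_edge_ge g a : gadget_edge (ge g a).
Proof. by apply/existsP; exists g; apply/existsP; exists a. Qed.

(* A linear relation supported on [S], in local form: [y g] are its seven
   coefficients on the gadget [g], and [x] is the potential whose coboundary it is. *)
Definition relation_on (F : fieldType) (S : {set 'I_(e + nq)}) (y : Gam -> nat -> F)
    (x : 'I_v -> F) :=
  [/\ forall u, u \in X -> x u = 0,
      forall g (a : 'I_3), combf (y g) a = x (s (ge g a)) - x (t (ge g a)),
      forall g l, (l < 7)%N -> y g l != 0 -> elt g l \in S,
      forall i, ~~ gadget_edge i -> lshift nq i \notin S -> x (s i) = x (t i)
    & (exists g l, (l < 7)%N /\ y g l != 0) \/
      (exists2 i, ~~ gadget_edge i & x (s i) != x (t i))].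

Lemma combfE (F : fieldType) (y : nat -> F) (a : 'I_3) :
  combf y a = y a + \sum_(k < 4) (nf (3 + k) a)%:~R * y (3 + k)%N.
Proof.
rewrite !big_ord_recl big_ord0 /combf /=.
by case: a => -[|[|[|]]] //= _; rewrite /nf /=; ring.
Qed.

Lemma cutmx_mul (F : fieldType) (x : 'cV[F]_v) i :
  (cutmx F *m x) i 0 = (s i \notin X)%:R * x (s i) 0 - (t i \notin X)%:R * x (t i) 0.
Proof.
rewrite mxE; under eq_bigr => u _ do rewrite mxE mulrBr mulrBl.
rewrite sumrB; congr (_ - _).
  rewrite (bigD1 (s i)) //= eqxx mulr1 big1 ?addr0 // => u /negPf.
  by rewrite eq_sym => ->; rewrite mulr0 mul0r.
rewrite (bigD1 (t i)) //= eqxx mulr1 big1 ?addr0 // => u /negPf.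
by rewrite eq_sym => ->; rewrite mulr0 mul0r.
Qed.

Lemma qmx_mul (F : fieldType) (y : 'cV[F]_nq) g a :
  (qmx F *m y) (ge g a) 0 = \sum_(k < 4) (nf (3 + k) a)%:~R * y (enum_rank (g, k)) 0.
Proof.
rewrite mxE (reindex (@enum_rank _)) /=; last by exists enum_val => j _; rewrite ?enum_rankK ?enum_valK.
rewrite (bigID (fun p => p.1 == g)) /= [X in _ + X]big1 ?addr0; last first.
  move=> p /negPf ng; rewrite mxE big1 ?mul0r // => b _; rewrite enum_rankK /=.
  by case: eqP => [/ge_inj[eg _]|]; rewrite ?mul0r //; rewrite eg eqxx in ng.
rewrite (reindex_onto (fun k : 'I_4 => (g, k)) snd) /=; last by case=> g' k /= /eqP->.
apply: eq_big => [k|k _]; first by rewrite !eqxx.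
rewrite mxE enum_rankK /= (bigD1 a) //= eqxx mul1r big1 ?addr0 // => b nb.
by case: eqP => [/ge_inj[_ eb]|]; rewrite ?mul0r //; rewrite eb eqxx in nb.
Qed.

Lemma qmx_mul0 (F : fieldType) (y : 'cV[F]_nq) i :
  ~~ gadget_edge i -> (qmx F *m y) i 0 = 0.
Proof.
move=> ni; rewrite mxE big1 // => j _; rewrite mxE big1 ?mul0r // => a _.
by rewrite /=; case: eqP => [ei|]; rewrite ?mul0r //; rewrite -ei gadget_edge_ge in ni.
Qed.


(** The relation [y] pushes forward to a vector of edge values orthogonal to all flows conserved
    outside [X]; by [kermx_annihilator] such vectors are the coboundaries of potentials vanishing on
    [X]. *)
Lemma gadget_mx_mul0 (F : fieldType) (y : 'cV[F]_(e + nq)) :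
  gadget_mx F *m y = 0 <->
  exists2 x : 'I_v -> F, (forall u, u \in X -> x u = 0) &
    forall i, y (lshift nq i) 0 + (qmx F *m dsubmx y) i 0 = x (s i) - x (t i).
Proof.
have E i : (row_mx 1%:M (qmx F) *m y) i 0 = y (lshift nq i) 0 + (qmx F *m dsubmx y) i 0.
  by rewrite -{1}[y]vsubmxK mul_row_col mul1mx [LHS]mxE [usubmx _ _ _]mxE.
rewrite /gadget_mx -mulmxA; split.
  case/kermx_annihilator => x ex; exists (fun u => (u \notin X)%:R * x u 0) => [u uX|i].
    by rewrite uX mul0r.
  by rewrite -E ex cutmx_mul.
case=> x xX h; rewrite (_ : row_mx _ _ *m y = cutmx F *m \col_u x u) ?mulmxA ?mulmx_ker ?mul0mx //.
apply/colP => i; rewrite E h cutmx_mul !mxE.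
have z u : (u \notin X)%:R * x u = x u.
  by case: (boolP (u \in X)) => [/xX->|_]; rewrite ?mulr0 ?mul1r.
by rewrite !z.
Qed.

Lemma dependent_relation (F : fieldType) (S : {set 'I_(e + nq)}) :
  S \notin vindep (gadget_mx F) -> exists y x, @relation_on F S y x.
Proof.
case/vindep_relation => y [yS /gadget_mx_mul0[x xX h] [j yj]].
exists (fun g l => y (elt g l) 0), x; split=> //.
- move=> g a; rewrite combfE -h qmx_mul /elt ltn_ord inord_val; congr (_ + _).
  apply: eq_bigr => k _; rewrite mxE /= addKn inord_val //.
- by move=> g l _; apply: contraR => /yS->.
- by move=> i ni /yS yi; apply/eqP; rewrite -subr_eq0 -h yi qmx_mul0 // add0r.
- case: (splitP j) => [i|p] ej.
    have {ej} ej : j = lshift nq i by apply: val_inj.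
    have [/existsP[g /existsP[a /eqP ei]]|ni] := boolP (gadget_edge i).
      left; exists g, a; split; first by rewrite (leq_trans (ltn_ord a)).
      by rewrite /elt ltn_ord inord_val ei -ej.
    right; exists i => //; rewrite -subr_eq0 -h qmx_mul0 // addr0 -ej //.
  have {ej} ej : j = rshift e p by apply: val_inj.
  left; exists (enum_val p).1, (3 + (enum_val p).2)%N; split.
    by rewrite ltn_add2l.
  by rewrite /elt /= addKn inord_val -surjective_pairing enum_valK -ej.
Qed.

Lemma relation_dependent (F : fieldType) (S : {set 'I_(e + nq)}) y x :
  @relation_on F S y x -> S \notin vindep (gadget_mx F).
Proof.
case=> xX hg hS hE nz.
(* Gadget edges take their local coefficient; on any other edge the coefficient is forced to be the
   potential difference. *)
pose yE i := if [pick p : Gam * 'I_3 | ge p.1 p.2 == i] is Some p then y p.1 p.2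
             else x (s i) - x (t i).
pose yQ (p : Gam * 'I_4) := y p.1 (3 + p.2)%N.
have yEg g (a : 'I_3) : yE (ge g a) = y g a.
  rewrite /yE; case: pickP => [[g' a'] /= /eqP /ge_inj[-> ->] //|/(_ (g, a))].
  by rewrite /= eqxx.
have yEn i : ~~ gadget_edge i -> yE i = x (s i) - x (t i).
  move=> ni; rewrite /yE; case: pickP => // [[g a] /= /eqP ei].
  by rewrite -ei gadget_edge_ge in ni.
pose Y : 'cV[F]_(e + nq) := col_mx (\col_i yE i) (\col_j yQ (enum_val j)).
have Yl i : Y (lshift nq i) 0 = yE i by rewrite col_mxEu mxE.
have Yr p : Y (rshift e p) 0 = yQ (enum_val p) by rewrite col_mxEd mxE.
have YS j : j \notin S -> Y j 0 = 0.
  move=> jS; case: (splitP j) => [i|p] ej.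
    have {}ej : j = lshift nq i by apply: val_inj.
    rewrite ej Yl; have [/existsP[g /existsP[a /eqP ei]]|ni] := boolP (gadget_edge i).
      rewrite -ei yEg; apply/eqP; apply: contraNT jS => /hS; rewrite /elt ltn_ord inord_val ei -ej.
      by apply; rewrite (leq_trans (ltn_ord a)).
    by rewrite yEn // hE ?subrr -?ej.
  have {}ej : j = rshift e p by apply: val_inj.
  rewrite ej Yr; apply/eqP; apply: contraNT jS => /hS.
  by rewrite /elt /= addKn inord_val -surjective_pairing enum_valK -ej; apply; rewrite ltn_add2l.
have Y0 : gadget_mx F *m Y = 0.
  apply/gadget_mx_mul0; exists x => // i; rewrite Yl.
  have [/existsP[g /existsP[a /eqP <-]]|ni] := boolP (gadget_edge i).
    rewrite -hg combfE qmx_mul yEg; congr (_ + _); apply: eq_bigr => k _.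
    by rewrite mxE Yr enum_rankK.
  by rewrite yEn // qmx_mul0 // addr0.
apply/negP => /vindep_relation0 /(_ YS Y0) eY.
have {}eY j : Y j 0 = 0 by rewrite eY mxE.
case: nz => [[g [l [l7 yl]]]|[i ni]]; last by rewrite -subr_eq0 -yEn // -Yl eY eqxx.
case/negP: yl; apply/eqP; have [l3|l3] := ltnP l 3.
  by have := yEg g (Ordinal l3); rewrite -Yl eY => /=.
have l4 : (l - 3 < 4)%N by lia.
have := Yr (enum_rank (g, Ordinal l4)); rewrite eY enum_rankK /yQ /= subnKC //.
Qed.

(** A gadget with a nontrivial relation among its own points is handled alone by [local_dep], with
    zero potential. Otherwise the potential is composed with [select c] for a suitable [c], and
    [local_span] supplies the coefficients on each gadget. *)
Lemma relation_transport (F F2 : fieldType) (S : {set 'I_(e + nq)}) y x :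
  (2 : F) != 0 -> (2 : F2) != 0 -> @relation_on F S y x ->
  exists y2 x2, @relation_on F2 S y2 x2.
Proof.
move=> h2 h2' [xX hg hS hE nz].
pose J g := mkseq (fun l => elt g l \in S) 7.
have sJ g : size (J g) = 7%N by rewrite size_mkseq.
have nJ g l : (l < 7)%N -> nth false (J g) l = (elt g l \in S) by move=> l7; rewrite nth_mkseq.
have hJ g l : (l < 7)%N -> y g l != 0 -> nth false (J g) l by move=> l7 /hS; rewrite nJ //; apply.
have [/existsP[g /andP[/existsP[l yl] /forallP wg]]|nA] :=
  boolP [exists g, [exists l : 'I_7, y g l != 0] && [forall a : 'I_3, combf (y g) a == 0]].
  have wg0 a : (a < 3)%N -> combf (y g) a = 0.
    by move=> a3; apply/eqP; apply: (wg (Ordinal a3)).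
  have [y2 [sy2 [l2 l27 y2l] w2]] := local_dep h2 h2' (sJ g) (ltn_ord l) yl (hJ g) wg0.
  exists (fun g' l => if g' == g then y2 l else 0), (fun=> 0); split=> //.
  - move=> g' a; rewrite subrr; case: eqP => _; first by apply: w2.
    by rewrite /combf !mul0r !addr0.
  - move=> g' k k7; case: (eqVneq g' g) => [->|_]; last by rewrite eqxx.
    by rewrite -nJ //; apply: sy2.
  - by left; exists g, l2; rewrite eqxx.
(* One end of each gadget edge lies in [X] and has potential 0, so the odd function [select c]
   commutes with the potential difference along the edge. *)
have key c : c != 0 -> exists y2,
    [/\ forall g (a : 'I_3), combf (y2 g) a =
          (select c (x (s (ge g a))))%:~R - (select c (x (t (ge g a))))%:~R :> F2,
        forall g l, (l < 7)%N -> y2 g l != 0 -> elt g l \in S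
      & forall g (a : 'I_3), combf (y2 g) a = (select c (combf (y g) a))%:~R].
  move=> c0.
  have /fin_all_exists[y2 hy2] := fun g => local_span h2 h2' (sJ g) c0 (hJ g).
  exists y2; split.
  - move=> g a; have [_ ->] := hy2 g; last exact: ltn_ord.
    rewrite hg; case/orP: (ge_X g a) => /xX->; rewrite select0 // ?subr0 ?sub0r //.
    by rewrite selectN // mulrNz.
  - by move=> g l l7; rewrite -nJ //; apply: (hy2 g).1.
  - by move=> g a; apply: (hy2 g).2; exact: ltn_ord.
have fin c y2 : c != 0 ->
    [/\ forall g (a : 'I_3), combf (y2 g) a =
          (select c (x (s (ge g a))))%:~R - (select c (x (t (ge g a))))%:~R :> F2,
        forall g l, (l < 7)%N -> y2 g l != 0 -> elt g l \in S
      & (exists g l, (l < 7)%N /\ y2 g l != 0) \/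
        (exists2 i, ~~ gadget_edge i &
           (select c (x (s i)))%:~R != (select c (x (t i)))%:~R :> F2)] ->
    exists y2 x2, @relation_on F2 S y2 x2.
  move=> c0 [h1 h3 h4]; exists y2, (fun u => (select c (x u))%:~R); split=> //.
    by move=> u /xX->; rewrite select0.
  by move=> i ni iS; rewrite (hE i).
(* The value [c] is taken to be a nonzero gadget value, or a nonzero potential at an end of the edge
   [i], so that something nonzero survives the selection. *)
case: nz => [[g [l [l7 yl]]]|[i ni nx]].
  have [a wa] : exists a : 'I_3, combf (y g) a != 0.
    apply/existsP; rewrite -negb_forall; apply: contra nA => w0.
    apply/existsP; exists g; rewrite w0 andbT.
    by apply/existsP; exists (Ordinal l7).
  have [y2 [k1 k2 k3]] := key _ wa; apply: (fin _ y2 wa); split=> //; left.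
  have : [exists l : 'I_7, y2 g l != 0].
    apply: contraT => /existsPn n0.
    have y0 k : (k < 7)%N -> y2 g k = 0.
      by move=> k7; apply/eqP; rewrite -[_ == _]negbK; exact: (n0 (Ordinal k7)).
    have := k3 g a; rewrite /combf !y0 // !mul0r !addr0 /select eqxx => /esym/eqP.
    by rewrite oner_eq0.
  by case/existsP => l2 y2l; exists g, l2; split; rewrite ?ltn_ord.
have sel c d : c != 0 -> d != c -> ((select c c)%:~R : F2) != (select c d)%:~R.
  move=> c0 dc; rewrite /select eqxx (negPf dc).
  by case: (eqVneq d (- c)) => _; rewrite ?oner_eq0 // -subr_eq0 mulrN1z opprK.
have [xs|xs] := eqVneq (x (s i)) 0.
  have xt : x (t i) != 0 by rewrite -xs eq_sym.
  have [y2 [k1 k2 k3]] := key _ xt; apply: (fin _ y2 xt); split=> //; right.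
  by exists i => //; rewrite eq_sym sel.
have [y2 [k1 k2 k3]] := key _ xs; apply: (fin _ y2 xs); split=> //; right.
by exists i => //; rewrite sel // eq_sym.
Qed.

Lemma gadget_vindep (F F2 : fieldType) : (2 : F) != 0 -> (2 : F2) != 0 ->
  vindep (gadget_mx F) = vindep (gadget_mx F2).
Proof.
move=> h2 h2'; apply/setP => S; apply/idP/idP; apply: contraLR.
  case/dependent_relation => y [x /(relation_transport h2' h2)[y2 [x2]]].
  exact: relation_dependent.
case/dependent_relation => y [x /(relation_transport h2 h2')[y2 [x2]]].
exact: relation_dependent.
Qed.

End GadgetMatrix.

(** * Vertical connectivity *)

Lemma rank_cols (F : fieldType) m n (A : 'M[F]_(m, n)) (S : {set 'I_n}) :
  \rank (cols A S) = rkf (fun i => row i A^T) S.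
Proof. by rewrite -mxrank_tr cols_colspan. Qed.

Lemma mrank_vector (F : fieldType) m n (A : 'M[F]_(m, n)) (S : {set 'I_n}) :
  mrank (vector_matroid A) S = \rank (cols A S).
Proof.
rewrite /mrank rank_cols; set f := fun i => row i A^T.
have freeE I : (I \in vindep A) = (rkf f I == #|I|) by rewrite inE rank_cols.
apply/eqP; rewrite eqn_leq; apply/andP; split.
  by apply/bigmax_leqP => I /andP[]; rewrite /= freeE => /eqP<- sI; apply: rkfS.
pose P (I : {set 'I_n}) := (I \in vindep A) && (I \subset S).
have P0 : P set0 by rewrite /P vindep0 sub0set.
have [I /maxsetP[PI maxI] _] := maxset_exists P0.
apply: leq_trans (leq_bigmax_cond _ PI).
move: PI; rewrite /P freeE => /andP[/eqP fI sI]; rewrite -fI; apply: mxrankS.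
apply/spanf_subP => x xS; have [xI|xI] := boolP (x \in I); first exact: spanf_mem.
apply: rkf_dep_mem => // /eqP fx.
have : x |: I = I.
  by apply: maxI; rewrite ?subsetUr // /P freeE fx subUset sub1set xS sI.
by move=> e; rewrite -e setU11 in xI.
Qed.

Lemma cols_mul (F : fieldType) m n (A : 'M[F]_(m, n)) (S : {set 'I_n}) :
  cols A S = A *m cols 1%:M S.
Proof. by rewrite /cols mulmx_colsub mulmx1. Qed.

Lemma rank_cols_full (F : fieldType) m n (A : 'M[F]_(m, n)) :
  \rank (cols A [set: 'I_n]) = \rank A.
Proof.
rewrite rank_cols -(mxrank_tr A); apply/eqP; rewrite eqn_leq; apply/andP; split; apply: mxrankS.
  by apply/spanf_subP => x _; apply: row_sub.
by apply/row_subP => i; apply: (@spanf_mem _ _ _ (fun i => row i A^T)).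
Qed.

(** The row space is viewed as a code; the dimension of this subcode is the amount by which the rank
    of [S] falls short of the full rank. *)
Definition vanishing (F : fieldType) m n (A : 'M[F]_(m, n)) (S : {set 'I_n}) : 'M[F]_n :=
  (A :&: kermx (cols 1%:M S))%MS.

Lemma rank_vanishing (F : fieldType) m n (A : 'M[F]_(m, n)) (S : {set 'I_n}) :
  (\rank (cols A S) + \rank (vanishing A S) = \rank A)%N.
Proof. by rewrite cols_mul mxrank_mul_ker. Qed.

Lemma vanishingP (F : fieldType) m n (A : 'M[F]_(m, n)) (S : {set 'I_n}) p (w : 'M[F]_(p, n)) :
  (w <= vanishing A S)%MS ->
  (w <= A)%MS /\ (forall i j, j \in S -> w i j = 0).
Proof.
rewrite sub_capmx => /andP[wA /sub_kermxP wS]; split=> // i j jS.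
have := congr1 (fun M : 'M_(p, #|S|) => M i (enum_rank_in jS j)) wS.
by rewrite -cols_mul !mxE enum_rankK_in.
Qed.

Lemma nspan_word (F : fieldType) m n (A : 'M[F]_(m, n)) (S : {set 'I_n}) :
  ~ spans (vector_matroid A) S ->
  exists2 w : 'rV[F]_n, (w <= vanishing A S)%MS & w != 0.
Proof.
move=> nS; suff : vanishing A S != 0 by case/rowV0Pn => w; exists w.
rewrite -mxrank_eq0; apply/eqP => r0; case: nS; apply/setP => x; rewrite !inE.
have := rank_vanishing A S; rewrite r0 addn0 => rS.
rewrite !mrank_vector eqn_leq; apply/andP; split; last first.
  by rewrite !rank_cols rkfS ?subsetUr.
by rewrite rS -(rank_cols_full A) !rank_cols rkfS ?subsetT.
Qed.

Lemma free_comb (F : fieldType) e v (D : 'M[F]_(e, v)) (S : {set 'I_e}) (z : 'rV_e) :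
  rkf (fun i => row i D) S = #|S| -> (forall i, i \notin S -> z 0 i = 0) ->
  z *m D = 0 -> z = 0.
Proof.
move=> fS zS zD.
have iS : S \in vindep D^T.
  rewrite inE rank_cols; apply/eqP; rewrite -[RHS]fS; congr (\rank _).
  by apply: eq_bigr => i _; rewrite trmxK.
apply: trmx_inj; rewrite trmx0; apply: (vindep_relation0 iS).
  by move=> i /zS; rewrite mxE.
by rewrite -trmx_mul zD trmx0.
Qed.

(** * Supports of flows and connectivity of the gadget matroid *)

Section Flows.
Variables (F : fieldType) (v e : nat) (s t : 'I_e -> 'I_v) (X : {set 'I_v}).
Variables (phi : 'I_v -> nat) (rho : nat).
Let rk := rkf (evec F s t).
Hypothesis girth : forall A : {set 'I_e}, (#|A| <= rho)%N -> rk A = #|A|.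
Hypothesis lip : lipschitz s t phi [set: 'I_e].
Hypothesis phi_dvd : forall u, u \in X -> (rho %| phi u)%N.
Hypothesis phi_inj : {in X &, injective phi}.

Definition incmx : 'M[F]_(e, v) := \matrix_i evec F s t i.

Lemma cutmx_incmx : cutmx s t X F = incmx *m diag_mx (\row_u (u \notin X)%:R).
Proof.
apply/matrixP => i u; rewrite mul_mx_diag !mxE eqxx /= mulrC.
by rewrite ![u == _]eq_sym.
Qed.

(** If the flow is conserved everywhere, its support is dependent and [girth] applies. Otherwise let
    [u0] be a vertex of nonzero divergence with [phi] minimal. The vertices of [X] lie at distinct
    multiples of [rho], so for [rho] consecutive levels [u0] is the only vertex of nonzero
    divergence at or below the level. The flow must cross each of these levels, and [crossing_rank]
    applies. *)
Lemma flow_support_rank (z : 'rV[F]_e) : z *m cutmx s t X F = 0 -> z != 0 ->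
  (rho <= rk [set i | z 0%R i != 0%R])%N.
Proof.
move=> zD z0; set S := [set i | _].
have zS i : i \notin S -> z 0 i = 0 by rewrite inE negbK => /eqP.
pose d := z *m incmx.
have dX u : u \notin X -> d 0 u = 0.
  move=> uX; have := congr1 (fun M : 'rV_v => M 0 u) zD.
  by rewrite cutmx_incmx mulmxA mul_mx_diag !mxE uX mulr1.
have dS : (d <= spanf (evec F s t) S)%MS.
  rewrite /d mulmx_sum_row summx_sub // => i _.
  have [iS|/zS->] := boolP (i \in S); last by rewrite scale0r sub0mx.
  by rewrite scalemx_sub // rowK spanf_mem.
have [d0|/rV0Pn[u1 du1]] := eqVneq d 0.
  apply: (girth_rank (E := setT)) => // [A _|fS]; first exact: girth.
  case/negP: z0; apply/eqP; apply: (free_comb (D := incmx) (S := S)) => //.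
  rewrite -[RHS]fS; congr (\rank _); apply: eq_bigr => i _; by rewrite rowK.
case: (@arg_minnP _ u1 (fun u => d 0 u != 0) phi du1) => u0 du0 min0.
have inX u : d 0 u != 0 -> u \in X by apply: contraNT => /dX->.
apply: (@crossing_rank _ _ _ _ _ phi _ (phi u0)).
  by move=> x _; apply: lip; rewrite inE.
move=> c /andP[c1 c2]; apply: (cross_exists (S := fun u => phi u <= c)%N dS).
have indE u : ind F (fun u => phi u <= c)%N u 0 = (phi u <= c)%N%:R by rewrite mxE.
rewrite mxE (bigD1 u0) //= indE c1 mulr1 big1 ?addr0 // => u uu0; rewrite indE.
have [uc|] := leqP (phi u) c; last by rewrite mulr0.
have [->|du] := eqVneq (d 0 u) 0; first by rewrite mul0r.
case/negP: uu0; apply/eqP; apply: phi_inj; rewrite ?inX //.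
have := min0 u du; have /dvdnP[a ea] := phi_dvd (inX _ du0).
have /dvdnP[b eb] := phi_dvd (inX _ du).
rewrite ea eb in c1 c2 uc *; have [->//|ne] := eqVneq a b.
by have [] := ltngtP a b => //; nia.
Qed.

Let rk' := rkf (fun i => row i (cutmx s t X F)).

Lemma rk_cut_le : (rk' [set: 'I_e] <= rk [set: 'I_e])%N.
Proof.
rewrite /rk' /rk; set Z := diag_mx (\row_u (u \notin X)%:R : 'rV[F]_v).
apply: leq_trans (mxrankM_maxl (spanf (evec F s t) [set: 'I_e]) Z).
apply: mxrankS; apply/spanf_subP => i iT; rewrite cutmx_incmx row_mul rowK.
by apply: submxMr; apply: spanf_mem.
Qed.

(** The unit vectors at [X] restore the coordinates zeroed by [cutmx]. *)
Lemma rk_le_cut (S : {set 'I_e}) : (rk S <= rk' S + #|X|)%N.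
Proof.
rewrite /rk /rk'; set f' := fun i => _; set dl := fun u => delta_mx 0 u : 'rV[F]_v.
apply: leq_trans (leq_add (leqnn _) (rkf_card dl X)).
apply: leq_trans (mxrank_adds_leqif _ _).1; apply: mxrankS; apply/spanf_subP => i iS.
have dlE c u w : (c *: dl w) 0 u = c * (u == w)%:R by rewrite !mxE.
have -> : evec F s t i = f' i + \sum_(u in X) (evec F s t i) 0 u *: dl u.
  apply/rowP => u; rewrite [RHS]mxE summxE /f' cutmx_incmx row_mul rowK mul_mx_diag.
  rewrite [X in _ = X + _]mxE [X in _ * X]mxE.
  have [uX|uX] := boolP (u \in X); last first.
    rewrite mulr1 big1 ?addr0 // => w wX; rewrite dlE.
    by case: (eqVneq u w) => [ew|]; rewrite ?mulr0 //; rewrite -ew (negPf uX) in wX.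
  rewrite mulr0 add0r (bigD1 u) //= dlE eqxx mulr1 big1 ?addr0 // => w /andP[_ wu].
  by rewrite dlE eq_sym (negPf wu) mulr0.
rewrite addmx_sub_adds ?spanf_mem // summx_sub // => u uX.
by rewrite scalemx_sub // (@spanf_mem _ _ _ dl).
Qed.

Variables (Gam : finType) (ge : Gam -> 'I_3 -> 'I_e) (kappa : nat).
Let nq := #|{: Gam * 'I_4}|.
Let M := gadget_mx s t X ge F.
Hypothesis linked : forall A B : {set 'I_e}, A :|: B = [set: 'I_e] -> A :&: B = set0 ->
  (rho <= rk A)%N -> (rho <= rk B)%N -> (rk [set: 'I_e] + kappa <= rk A + rk B)%N.

Lemma gadget_word p (w : 'M[F]_(p, e + nq)) : (w <= M)%MS ->
  lsubmx w *m cutmx s t X F = 0 /\ w = lsubmx w *m row_mx 1%:M (qmx ge F).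
Proof.
case/submxP => y ->; rewrite /M /gadget_mx mulmxA.
have -> : lsubmx (y *m kermx (cutmx s t X F) *m row_mx 1%:M (qmx ge F)) =
  y *m kermx (cutmx s t X F) by rewrite mul_mx_row row_mxKl mulmx1.
by rewrite -mulmxA mulmx_ker mulmx0.
Qed.

Lemma rank_gadget_mx : (\rank M + rk' [set: 'I_e] = e)%N.
Proof.
have -> : \rank M = \rank (kermx (cutmx s t X F)).
  apply/eqP; rewrite eqn_leq mxrankM_maxl /=.
  have {1}-> : kermx (cutmx s t X F) = M *m col_mx 1%:M 0.
    by rewrite /M /gadget_mx -mulmxA mul_row_col mulmx1 mulmx0 addr0 mulmx1.
  exact: mxrankM_maxl.
have -> : rk' [set: 'I_e] = \rank (cutmx s t X F).
  rewrite -mxrank_tr -rank_cols_full rank_cols; congr (\rank _).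
  by apply: eq_bigr => i _; rewrite trmxK.
by rewrite mxrank_ker subnK // rank_leq_row.
Qed.

(** A word vanishing on [A] is determined by its flow, which lives on the edges outside [A]; such
    flows form part of the left kernel of the corresponding rows of the cut matrix. *)
Lemma vanishing_gadget_rank (A : {set 'I_(e + nq)}) :
  (\rank (vanishing M A) + rk' [set i | lshift nq i \notin A]
     <= #|[set i | lshift nq i \notin A]|)%N.
Proof.
set B := [set i | _]; set U := vanishing M A.
have [UM UA] := vanishingP (submx_refl U).
have [Uc Ue] := gadget_word UM.
pose Sel : 'M[F]_(#|B|, e) := rowsub enum_val 1%:M.
pose V : 'M[F]_(e + nq, #|B|) := colsub enum_val (lsubmx U).
have UV : lsubmx U = V *m Sel.
  apply/matrixP => i j; rewrite [RHS]mxE [LHS]mxE.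
  have [jB|jB] := boolP (j \in B); last first.
    rewrite UA; last by move: jB; rewrite inE negbK.
    rewrite big1 // => k _; rewrite !mxE; case: eqP => [ek|]; last by rewrite mulr0.
    by rewrite -ek enum_valP in jB.
  rewrite (bigD1 (enum_rank_in jB j)) //= !mxE enum_rankK_in // eqxx mulr1 big1 ?addr0 // => k nk.
  rewrite !mxE; case: eqP => [ek|]; last by rewrite mulr0.
  by case/eqP: nk; apply: enum_val_inj; rewrite enum_rankK_in.
have rU : (\rank U <= \rank V)%N.
  apply: leq_trans (mxrankM_maxl V Sel); rewrite -UV {1}Ue; exact: mxrankM_maxl.
have rS : \rank (Sel *m cutmx s t X F) = rk' B.
  rewrite -mxrank_tr (_ : (_ *m _)^T = cols (cutmx s t X F)^T B).
    by rewrite rank_cols; congr (\rank _); apply: eq_bigr => i _; rewrite trmxK.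
  by rewrite mul_rowsub_mx mul1mx; apply/matrixP => i j; rewrite !mxE.
have : (V <= kermx (Sel *m cutmx s t X F))%MS.
  by apply/sub_kermxP; rewrite mulmxA -UV Uc.
move/mxrankS; rewrite mxrank_ker rS.
have : (rk' B <= #|B|)%N by apply: rkf_card.
lia.
Qed.

Lemma vanishing_support (A : {set 'I_(e + nq)}) (w : 'rV[F]_(e + nq)) :
  (w <= vanishing M A)%MS -> w != 0 -> (rho <= rk [set i | lshift nq i \notin A])%N.
Proof.
move=> /vanishingP[wM wA] w0; have [wc we] := gadget_word wM.
have z0 : lsubmx w != 0 by apply: contraNneq w0 => z0; rewrite we z0 mul0mx.
apply: leq_trans (flow_support_rank wc z0) _; apply: rkfS; apply/subsetP => i.
rewrite !inE mxE => wi; apply/negP => iA.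
by move: wi; rewrite wA ?eqxx.
Qed.

(** If neither side spans, a nonzero word vanishes on each, so the edge sets [cA] and [cB] both have
    rank at least [rho] and [linked] applies. The order of the separation is at least rk' cA + rk'
    cB - rk' setT; replacing [rk'] by [rk] costs [#|X|] for each side, which leaves at least
    [kappa - 2 * #|X|]. *)
Lemma gadget_connected k : (k + 2 * #|X| <= kappa)%N -> (0 < k)%N ->
  vertically_connected k (vector_matroid M).
Proof.
move=> ek k0 A B uAB iAB; rewrite !mrank_vector rank_cols_full => lt.
have decS (S : {set 'I_(e + nq)}) : spans (vector_matroid M) S \/ ~ spans (vector_matroid M) S.
  rewrite /spans; case: (eqVneq (mclosure (vector_matroid M) S) [set: 'I_(e + nq)]) => h.
    by left.
  by right; apply/eqP.
have [|nA] := decS A; first by left.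
have [|nB] := decS B; first by right.
have [w wA w0] := nspan_word nA; have [w' wB w0'] := nspan_word nB.
have rA := vanishing_support wA w0; have rB := vanishing_support wB w0'.
have vA := vanishing_gadget_rank A; have vB := vanishing_gadget_rank B.
move: rA rB vA vB => /=; set cA := [set i | _ \notin A]; set cB := [set i | _ \notin B].
move=> rA rB vA vB.
have inAB i : (lshift nq i \in A) = ~~ (lshift nq i \in B).
  have /setP/(_ (lshift nq i)) := uAB; have /setP/(_ (lshift nq i)) := iAB.
  by rewrite !inE; case: (_ \in A); case: (_ \in B).
have uc : cA :|: cB = setT by apply/setP => i; rewrite !inE inAB; case: (_ \in B).
have ic : cA :&: cB = set0 by apply/setP => i; rewrite !inE inAB; case: (_ \in B).
have := linked uc ic rA rB; have := rk_le_cut cA; have := rk_le_cut cB; have := rk_cut_le.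
have := rank_gadget_mx; have := rank_vanishing M A; have := rank_vanishing M B.
have : (#|cA| + #|cB| = e)%N by rewrite -cardsUI ic cards0 addn0 uc cardsT card_ord.
move: lt vA vB ek; move: (rk' _) (rk' _) (rk' _) (rk _) (rk _) (rk _) => a1 a2 a3 a4 a5 a6.
move: (\rank _) (\rank _) (\rank _) (\rank _) (\rank _) #|cA| #|cB| #|X| => b1 b2 b3 b4 b5 b6 b7 b8.
lia.
Qed.

End Flows.

(** * Perturbations of frame matroids and of their duals *)

Definition sparse (F : fieldType) p n (A : 'M[F]_(p, n)) :=
  forall j, (#|[set i | A i j != 0%R]| <= 2)%N.

Lemma sparse_scale (F : fieldType) p n (A : 'M[F]_(p, n)) (d : 'rV_n) :
  sparse A -> sparse (A *m diag_mx d).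
Proof.
move=> sA j; apply: leq_trans (sA j); apply: subset_leq_card; apply/subsetP => i.
by rewrite !inE mul_mx_diag mxE; apply: contraNN => /eqP->; rewrite mul0r.
Qed.

Lemma rank_scale (F : fieldType) p n (A : 'M[F]_(p, n)) (d : 'rV_n) :
  (forall j, d 0 j != 0) -> \rank (A *m diag_mx d) = \rank A.
Proof. by move=> nz; rewrite mxrankMfree // row_free_unit diag_mx_unit. Qed.

(* The combinations of rows that are killed by the perturbing matrix form a
   common subspace of small codimension of both row spaces. *)
Lemma perturbation_common (F : fieldType) n t (N M : rmatroid F n) :
  perturbation t N M ->
  exists (d : 'rV[F]_n) (m : nat) (W : 'M[F]_(m, n)),
    [/\ forall j, d 0 j != 0,
        (W <= rm_mx N *m diag_mx d)%MS, (W <= rm_mx M)%MS,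
        (\rank (rm_mx N) <= \rank W + t)%N & (\rank (rm_mx M) <= \rank W + t)%N].
Proof.
case=> m [A [P [/rep_equiv_rowspace[d1 n1 /= e1] rP /rep_equiv_rowspace[d2 n2 /= e2]]]].
exists (\row_j ((\row_i (d1 0 i)^-1) 0 j * d2 0 j)), m, (kermx P *m A *m diag_mx d2).
have eW : kermx P *m A = kermx P *m (A + P) by rewrite mulmxDr mulmx_ker addr0.
have rk B : (\rank B <= \rank (kermx P *m B) + t)%N.
  by have := mxrank_mul_min (kermx P) B; rewrite mxrank_ker; have := rank_leq_row P; lia.
split.
- by move=> j; rewrite !mxE mulf_neq0 ?invr_neq0.
- rewrite -mulmx_diag mulmxA; apply: submxMr.
  have <- : A *m diag_mx d1 *m diag_mx (\row_j (d1 0 j)^-1) = A.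
    by rewrite -mulmxA mul_diag_mxV // mulmx1.
  by rewrite mulmxA submxMr //; apply: submx_trans (submxMl _ _) _; rewrite e1.
- by rewrite eW -mulmxA; apply: submx_trans (submxMl _ _) _; rewrite e2.
- by rewrite rank_scale // -e1 rank_scale.
- by rewrite eW rank_scale // -e2 rank_scale.
Qed.

Lemma perturbation_frame (F : fieldType) n t (N M : rmatroid F n) :
  frame N -> perturbation t N M ->
  exists p (A : 'M[F]_(p, n)) m (W : 'M[F]_(m, n)),
    [/\ sparse A, (W <= A)%MS, (W <= rm_mx M)%MS,
        (\rank A <= \rank W + t)%N & (\rank (rm_mx M) <= \rank W + t)%N].
Proof.
case=> p [A [/rep_equiv_rowspace[d1 n1 /= e1] sA]].
case/perturbation_common => d [m [W [nz WN WM rN rM]]].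
exists p, (A *m diag_mx d1 *m diag_mx d), m, W; split=> //.
- by do 2!apply: sparse_scale.
- by rewrite (eqmxMr _ e1).
- by rewrite rank_scale // e1.
Qed.

(** Scaling the dual by [d] amounts to scaling the sparse matrix by the inverse of [d], which keeps
    it sparse. *)
Lemma perturbation_coframe (F : fieldType) n t (N M : rmatroid F n) :
  frame N -> perturbation t (rdual N) M ->
  exists p (A : 'M[F]_(p, n)) m (W : 'M[F]_(m, n)),
    [/\ sparse A, (W <= kermx A^T)%MS, (W <= rm_mx M)%MS,
        (\rank (kermx A^T) <= \rank W + t)%N & (\rank (rm_mx M) <= \rank W + t)%N].
Proof.
case=> p [A [/rep_equiv_rowspace[d1 n1 /= e1] sA]].
case/perturbation_common => d [m [W [nz WN WM rN rM]]].
pose d' := \row_j (d 0 j)^-1.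
have nz' j : d' 0 j != 0 by rewrite mxE invr_neq0.
have dd' : diag_mx d *m diag_mx d' = 1%:M by apply: mul_diag_mxV.
exists p, (A *m diag_mx d1 *m diag_mx d'), m, W; split=> //.
- by do 2!apply: sparse_scale.
- apply: submx_trans WN _; apply/sub_kermxP => /=.
  have /submxP[B eB] : (A *m diag_mx d1 <= rm_mx N)%MS by rewrite e1.
  have := mulmx_ker (rm_mx N)^T; move: (kermx _) => K KN.
  rewrite eB trmx_mul tr_diag_mx trmx_mul -!mulmxA (mulmxA (diag_mx d)) dd' mul1mx.
  by rewrite mulmxA KN mul0mx.
- by apply: leq_trans rN; rewrite /= !mxrank_ker !mxrank_tr rank_scale // e1.
Qed.

Lemma row_free_rowsub (F : fieldType) p q n (A : 'M[F]_(p, n)) (h : 'I_q -> 'I_p) :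
  injective h -> row_free A -> row_free (rowsub h A).
Proof.
move=> ih fA; rewrite -[A]mul1mx -mul_rowsub_mx /row_free mxrankMfree //.
apply/row_freeP; exists (rowsub h 1%:M)^T; apply/matrixP => i j; rewrite !mxE.
rewrite (bigD1 (h i)) //= !mxE eqxx mul1r (inj_eq ih) eq_sym big1 ?addr0 // => k.
by rewrite !mxE => /negPf; rewrite eq_sym => ->; rewrite mul0r.
Qed.

Definition weight (F : fieldType) n (w : 'rV[F]_n) := #|[set j | w 0 j != 0]|.

Lemma weight_sub_rows (F : fieldType) q n (A : 'M[F]_(q, n)) (w : 'rV_n) :
  (w <= A)%MS -> (weight w <= \sum_(i < q) weight (row i A))%N.
Proof.
case/submxP => x ->; apply: (@leq_trans #|\bigcup_(i < q) [set j | row i A 0 j != 0]|).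
  apply: subset_leq_card; apply/subsetP => j; rewrite inE => wj; apply/bigcupP.
  apply/exists_inP; apply: contraNT wj => /exists_inPn h.
  rewrite mxE big1 // => i _; have := h i isT; rewrite inE negbK mxE => /eqP->.
  by rewrite mulr0.
elim/big_ind2: _ => [|U a V b hU hV|i _ //]; first by rewrite cards0.
by apply: leq_trans (leq_card_setU _ _) (leq_add hU hV).
Qed.

Lemma sparse_weight (F : fieldType) p n (A : 'M[F]_(p, n)) :
  sparse A -> (\sum_(i < p) weight (row i A) <= 2 * n)%N.
Proof.
move=> sA; under eq_bigr => i _ do rewrite /weight -sum1_card big_mkcond /=.
rewrite exchange_big /=; have -> : (2 * n = \sum_(j < n) 2)%N.
  by rewrite sum_nat_const card_ord mulnC.
apply: leq_sum => j _.
apply: leq_trans (sA j); rewrite -big_mkcond /= sum1_card.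
apply: subset_leq_card; apply/subsetP => i h.
by have : j \in [set k | row i A 0 k != 0] := h; rewrite !inE mxE.
Qed.

(** Split independent rows of [A] into groups of [t.+1]. The span of each group meets [W]
    nontrivially, so its rows have total weight at least [rho], while all rows together have at most
    [2 * n] nonzero entries. *)
Lemma frame_weight (F : fieldType) p n m t rho (A : 'M[F]_(p, n)) (W : 'M[F]_(m, n)) :
  sparse A -> (W <= A)%MS -> (\rank A <= \rank W + t)%N ->
  (forall w : 'rV_n, (w <= W)%MS -> w != 0 -> (rho <= weight w)%N) ->
  (\rank A %/ t.+1 * rho <= 2 * n)%N.
Proof.
move=> sA WA rA hw; pose f := maxrankfun A; set q := \rank A in f *.
pose B := rowsub f A.
have fB : row_free B by rewrite /row_free eq_maxrowsub.
have sB : sparse B.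
  move=> j; apply: leq_trans (sA j).
  rewrite -(card_imset _ (@maxrankfun_inj _ _ _ A)); apply: subset_leq_card.
  by apply/subsetP => i /imsetP[k]; rewrite !inE mxE => h ->.
apply: leq_trans (sparse_weight sB).
set b := (q %/ t.+1)%N.
(* Group [c] consists of the rows r * b + c for [r < t.+1]; at most [t] rows are left over. *)
have hlt (c : 'I_b) (r : 'I_t.+1) : (r * b + c < q)%N.
  have := leq_trunc_div q t.+1; rewrite -/b; have := ltn_ord c; have := ltn_ord r; nia.
pose h (x : 'I_b * 'I_t.+1) := Ordinal (hlt x.1 x.2).
have ih : injective h.
  move=> [c r] [c' r'] /(congr1 val) /= E.
  have b0 : (0 < b)%N by apply: leq_ltn_trans (ltn_ord c).
  have ec : c = c' by apply: val_inj; move: (congr1 (modn^~ b) E); rewrite !modnMDl !modn_small.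
  have er : r = r'.
    by apply: val_inj; move: (congr1 (divn^~ b) E); rewrite !divnMDl // !divn_small ?addn0.
  by rewrite ec er.
have key (c : 'I_b) : (rho <= \sum_(r < t.+1) weight (row (h (c, r)) B))%N.
  pose C := rowsub (fun r => h (c, r)) B.
  have fC : row_free C.
    by apply: row_free_rowsub => // r r' /ih[].
  have CA : (C <= A)%MS.
    apply/row_subP => r; rewrite row_rowsub row_rowsub; exact: row_sub.
  have : (C :&: W)%MS != 0.
    rewrite -mxrank_eq0 -lt0n; have := mxrank_sum_cap C W.
    have : (\rank (C + W) <= q)%N by apply: mxrankS; rewrite addsmx_sub CA.
    move: fC; rewrite /row_free => /eqP->; lia.
  case/rowV0Pn => w; rewrite sub_capmx => /andP[wC wW] w0.
  apply: leq_trans (hw w wW w0) _; apply: leq_trans (weight_sub_rows wC) _.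
  by apply: leq_sum => r _; rewrite row_rowsub.
apply: (@leq_trans (\sum_(c < b) \sum_(r < t.+1) weight (row (h (c, r)) B))%N).
  have -> : (b * rho = \sum_(c < b) rho)%N by rewrite sum_nat_const card_ord.
  by apply: leq_sum => c _; apply: key.
rewrite pair_big /=.
have -> : (\sum_(x : 'I_b * 'I_t.+1) weight (row (h (x.1, x.2)) B) =
          \sum_(i in [set h x | x in setT]) weight (row i B))%N.
  rewrite big_imset /=; last by move=> x y _ _; apply: ih.
  by apply: eq_big => [x|[c r] _ //]; rewrite inE.
by rewrite [leqRHS](bigID (mem [set h x | x in setT])) /= leq_addr.
Qed.

(* Eliminating a coordinate merges the (at most two) rows in which it occurs. *)
Lemma sparse_puncture1 (F : fieldType) p n (A : 'M[F]_(p, n)) (j : 'I_n) : sparse A ->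
  exists B : 'M[F]_(p, n), [/\ sparse B, forall i, B i j = 0,
    forall l, (forall i, A i l = 0) -> forall i, B i l = 0
  & forall z : 'cV_n, B *m z = 0 -> exists c, A *m (z + c *: delta_mx j 0) = 0] /\
    (forall (z : 'cV_n) c, A *m (z + c *: delta_mx j 0) = 0 -> B *m z = 0).
Proof.
move=> sA.
have Ad c : A *m (c *: delta_mx j 0) = c *: col j A :> 'cV_p by rewrite -scalemxAr -colE.
have [/existsP[a Aa]|/existsPn zA] := boolP [exists a, A a j != 0]; last first.
  have cj : col j A = 0 by apply/colP => i; rewrite !mxE; apply/eqP; rewrite -[_ == _]negbK zA.
  exists A; split; first split=> //.
  - by move=> i; apply/eqP; rewrite -[_ == _]negbK zA.
  - by move=> z Az; exists 0; rewrite scale0r addr0.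
  - by move=> z c; rewrite mulmxDr Ad cj scaler0 addr0.
pose B := A - (A a j)^-1 *: (col j A *m row a A).
have BE i l : B i l = A i l - (A a j)^-1 * (A i j * A a l).
  by rewrite !mxE big_ord1 !mxE.
have Bj i : B i j = 0 by rewrite BE [A i j * _]mulrC mulKf // subrr.
have Ba l : B a l = 0 by rewrite BE mulKf // subrr.
have Bz z : B *m z = A *m z - (A a j)^-1 *: (col j A *m (row a A *m z)).
  by rewrite mulmxBl -scalemxAl mulmxA.
have sc (w : 'cV[F]_1) : col j A *m w = w 0 0 *: col j A.
  by rewrite [w in LHS]mx11_scalar mul_mx_scalar.
exists B; split; first split=> //.
- move=> l; have [al|al] := eqVneq (A a l) 0.
    apply: leq_trans (sA l); apply: subset_leq_card; apply/subsetP => i.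
    by rewrite !inE BE al !mulr0 subr0.
  (* The pivot row [a] of [B] vanishes, so column [l] trades its entry there for at most the one
     other entry of column [j]. *)
  have sub : [set i | B i l != 0] \subset
      ([set i | A i l != 0] :\ a) :|: ([set i | A i j != 0] :\ a).
    apply/subsetP => i; rewrite !inE => Bi.
    have -> /= : i != a by apply: contraNneq Bi => ->; rewrite Ba.
    apply: contraNT Bi; rewrite negb_or !negbK => /andP[/eqP Ai /eqP Aj].
    by rewrite BE Ai Aj mul0r mulr0 subr0.
  apply: leq_trans (subset_leq_card sub) _; apply: leq_trans (leq_card_setU _ _) _.
  have := sA l; have := sA j; rewrite (cardsD1 a [set i | A i l != 0]) (cardsD1 a [set i | A i j != 0]).
  by rewrite !inE al Aa; lia.
- by move=> l zl i; rewrite BE !zl !mulr0 subr0.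
- move=> z; rewrite Bz sc => E; exists (- (A a j)^-1 * (row a A *m z) 0 0).
  by rewrite mulmxDr Ad -scalerA scaleNr -E.
- move=> z c E; have : B *m (z + c *: delta_mx j 0) = 0 by rewrite Bz -row_mul E row0 mulmx0 scaler0 subr0.
  rewrite mulmxDr -scalemxAr -colE => <-.
  by rewrite (_ : col j B = 0) ?scaler0 ?addr0 //; apply/colP => i; rewrite mxE Bj mxE.
Qed.

(** Eliminating the coordinates one at a time projects the kernel away from [S]. The third
    conclusion keeps columns that are already zero at zero through the induction. *)
Lemma sparse_puncture (F : fieldType) p n (A : 'M[F]_(p, n)) (S : {set 'I_n}) : sparse A ->
  exists B : 'M[F]_(p, n), [/\ sparse B, forall i j, j \in S -> B i j = 0,
    forall l, (forall i, A i l = 0) -> forall i, B i l = 0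
  & forall z : 'cV_n, B *m z = 0 <->
      exists2 z' : 'cV_n, (forall j, j \notin S -> z' j 0 = z j 0) & A *m z' = 0].
Proof.
have [k] := ubnP #|S|; elim: k S A => // k IH S A.
have [->|[j jS]] := set_0Vmem S => cS sA.
  exists A; split=> // [i j|z]; first by rewrite inE.
  split=> [Az|[z' e]]; first by exists z.
  by rewrite (_ : z' = z) //; apply/colP => j; apply: e; rewrite inE.
have [B [[sB Bj Bz B1] B2]] := sparse_puncture1 j sA.
have cS' : (#|S :\ j| < k)%N by move: cS; rewrite (cardsD1 j S) jS; lia.
have [C [sC CS Cz CE]] := IH (S :\ j) B cS' sB.
exists C; split=> //.
- move=> i l lS; have [->|lj] := eqVneq l j; first exact: Cz.
  by apply: CS; rewrite !inE lj.
- by move=> l /Bz /Cz.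
move=> z; rewrite CE; split.
  case=> z' e /B1[c Ac]; exists (z' + c *: delta_mx j 0) => // l lS.
  have lj : l != j by apply: contraNneq lS => ->.
  by rewrite !mxE (negPf lj) mulr0 addr0 e // !inE (negPf lS) andbF.
case=> z' e Az'; exists (z' + (z j 0 - z' j 0) *: delta_mx j 0) => [l|]; last first.
  apply: (B2 _ (- (z j 0 - z' j 0))).
  by rewrite scaleNr addrK.
rewrite !inE negb_and negbK !mxE => /orP[/eqP->|lS]; first by rewrite !eqxx mulr1 addrC subrK.
have lj : l != j by apply: contraNneq lS => ->.
by rewrite (negPf lj) mulr0 addr0 e.
Qed.

Lemma rank_cap_le (F : fieldType) m1 m2 m3 n t (C : 'M[F]_(m1, n)) (W : 'M[F]_(m2, n))
    (Z : 'M[F]_(m3, n)) :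
  (W <= C)%MS -> (\rank C <= \rank W + t)%N ->
  (\rank (C :&: Z)%MS <= \rank (W :&: Z)%MS + t)%N.
Proof.
move=> WC rC; have := mxrank_sum_cap (C :&: Z)%MS W.
have : (\rank (C :&: Z + W)%MS <= \rank C)%N.
  by apply: mxrankS; rewrite addsmx_sub capmxSl.
have : (\rank ((C :&: Z) :&: W)%MS <= \rank (W :&: Z)%MS)%N.
  apply: mxrankS; rewrite sub_capmx capmxSr /=.
  by apply: submx_trans (capmxSl _ _) (capmxSr _ _).
lia.
Qed.

Definition maskmx (F : fieldType) n (K : {set 'I_n}) : 'M[F]_n :=
  diag_mx (\row_j (j \in K)%:R).

Lemma mul_maskmx (F : fieldType) m n (A : 'M[F]_(m, n)) (K : {set 'I_n}) i j :
  (A *m maskmx F K) i j = if j \in K then A i j else 0.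
Proof. by rewrite mul_mx_diag !mxE; case: ifP; rewrite ?mulr1 ?mulr0. Qed.

Lemma rank_maskmx (F : fieldType) n (K : {set 'I_n}) : (#|K| <= \rank (maskmx F K))%N.
Proof.
pose R : 'M[F]_(#|K|, n) := rowsub enum_val 1%:M.
have fR : row_free R by apply: row_free_rowsub; [exact: enum_val_inj | rewrite row_free_unit unitmx1].
have <- : \rank R = #|K| by apply/eqP.
have -> : R = R *m maskmx F K; last exact: mxrankM_maxr.
apply/matrixP => i j; rewrite mul_maskmx !mxE; case: ifP => // jK.
by case: eqP => // ej; rewrite -ej enum_valP in jK.
Qed.

(** On the kernel side of [A], the coordinates in [Y] are forced to zero and those in [S] are
    projected away. Words of [U] that lie in [W] remain orthogonal to [B], and they have codimension
    at most [t] in [U]. Conversely, a vector on [K] killed by [B] lifts to a word of [kermx A^T]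
    vanishing on [Y], and the space of such words has rank at most [L + t]. *)
Lemma coframe_minor (F : fieldType) p m q n L t (A : 'M[F]_(p, n)) (W : 'M[F]_(m, n))
    (C : 'M[F]_(q, n)) (U : 'M[F]_(L, n)) (Y S K : {set 'I_n}) :
  sparse A -> (W <= kermx A^T)%MS -> (\rank (kermx A^T) <= \rank W + t)%N ->
  (W <= C)%MS -> (\rank C <= \rank W + t)%N ->
  (U <= C)%MS -> row_free U -> (forall i j, j \in Y -> U i j = 0) ->
  (\rank (vanishing C Y) <= L)%N ->
  (forall j, [|| j \in K, j \in S | j \in Y]) -> [disjoint K & S] -> [disjoint K & Y] ->
  exists B : 'M[F]_(p, n),
    [/\ sparse B, forall i j, j \notin K -> B i j = 0,
        (\rank (B *m U^T) <= t)%N & (#|K| <= \rank B + L + t)%N].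
Proof.
move=> sA WA rA WC rC UC fU UY rY cov dKS dKY.
pose A1 := A *m maskmx F (~: Y).
have [B [sB BS Bz BE]] := sparse_puncture S (sparse_scale _ sA : sparse A1).
have A1z (z : 'cV_n) : (forall j, j \in Y -> z j 0 = 0) -> A1 *m z = A *m z.
  move=> zY; rewrite /A1 -mulmxA; congr (_ *m _); apply/colP => j.
  rewrite mul_diag_mx !mxE inE; case: (boolP (j \in Y)) => [/zY->|_]; by rewrite ?mulr0 ?mul1r.
exists B; split=> //.
- move=> i j jK; have := cov j; rewrite (negPf jK) /= => /orP[/BS//|jY].
  apply: Bz => k; rewrite mul_maskmx inE jY //.
- have sub : (U :&: W <= U :&: kermx B^T)%MS.
    rewrite sub_capmx capmxSl; apply/row_subP => i.
    have : (row i (U :&: W)%MS <= U :&: W)%MS by apply: row_sub.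
    move: (row i _) => w; rewrite sub_capmx => /andP[wU wW].
    have /sub_kermxP wA : (w <= kermx A^T)%MS by apply: submx_trans wW WA.
    apply/sub_kermxP; apply: trmx_inj; rewrite trmx_mul trmxK trmx0; apply/BE.
    exists w^T => //; rewrite A1z; first by rewrite -[A]trmxK -trmx_mul wA trmx0.
    move=> j jY; case/submxP: wU => x ->; rewrite !mxE big1 // => k _.
    by rewrite UY // mulr0.
  have := mxrank_mul_ker U B^T; have := mxrankS sub; have := mxrank_sum_cap U W.
  have : (\rank (U + W)%MS <= \rank C)%N by apply: mxrankS; rewrite addsmx_sub UC WC.
  have -> : \rank (U *m B^T) = \rank (B *m U^T) by rewrite -mxrank_tr trmx_mul trmxK.
  move: fU; rewrite /row_free => /eqP->; lia.
- pose V := maskmx F K; pose V1 := vanishing (kermx A^T) Y.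
  have rV1 : (\rank V1 <= L + t)%N.
    apply: leq_trans (rank_cap_le _ WA rA) _; rewrite leq_add2r.
    apply: leq_trans rY; apply: mxrankS; rewrite sub_capmx capmxSr andbT.
    by apply: submx_trans (capmxSl _ _) WC.
  have sub : (V :&: kermx B^T <= V1 *m V)%MS.
    apply/row_subP => i; have : (row i (V :&: kermx B^T)%MS <= V :&: kermx B^T)%MS by apply: row_sub.
    move: (row i _) => w; rewrite sub_capmx => /andP[wV /sub_kermxP wB].
    have wK j : j \notin K -> w 0 j = 0.
      by move=> jK; case/submxP: wV => x ->; rewrite mul_maskmx (negPf jK).
    have /BE[z zS Az] : B *m w^T = 0 by rewrite -[B]trmxK -trmx_mul wB trmx0.
    pose z1 := z^T *m maskmx F (~: Y).
    have -> : w = z1 *m V.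
      apply/rowP => j; rewrite mul_maskmx mul_maskmx inE.
      have [jK|jK] := boolP (j \in K); last by rewrite wK.
      rewrite (disjointFr dKY jK) mxE zS ?mxE //.
      by rewrite (disjointFr dKS jK).
    apply: submxMr; rewrite sub_capmx; apply/andP; split; apply/sub_kermxP.
      have -> : z1 *m A^T = (A1 *m z)^T.
        by rewrite trmx_mul /A1 trmx_mul tr_diag_mx mulmxA.
      by rewrite Az trmx0.
    rewrite -cols_mul; apply/matrixP => a b; rewrite mxE mul_maskmx inE.
    by rewrite (enum_valP b) [RHS]mxE.
  have := mxrankS sub; have := mxrankM_maxl V1 V; have := mxrank_mul_ker V B^T.
  have := mxrankM_maxr V B^T; rewrite mxrank_tr; have := rank_maskmx F K; rewrite -/V; lia.
Qed.

Lemma card_bigcup_le (I T : finType) (P : {set I}) (f : I -> {set T}) w :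
  (forall i, i \in P -> #|f i| <= w)%N -> (#|\bigcup_(i in P) f i| <= #|P| * w)%N.
Proof.
move=> h; rewrite -sum_nat_const.
elim/big_ind2: _ => [|X a Y b hX hY|i /h //]; first by rewrite cards0.
by apply: leq_trans (leq_card_setU _ _) (leq_add hX hY).
Qed.

(** At most [t] columns span all the others, so a nonzero row already has a nonzero entry in one of
    them. *)
Lemma low_rank_sparse_rows (F : fieldType) p L w t (B : 'M[F]_(p, L)) :
  (\rank B <= t)%N -> (forall j, #|[set i | B i j != 0%R]| <= w)%N ->
  (#|[set i | row i B != 0%R]| <= t * w)%N.
Proof.
move=> rB cB; pose f := maxrankfun B^T.
have /submxP[X eX] : (B^T <= rowsub f B^T)%MS by rewrite eq_maxrowsub.
have sub : [set i | row i B != 0] \subset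
    \bigcup_(k in [set: 'I_(\rank B^T)]) [set i | B i (f k) != 0].
  apply/subsetP => i; rewrite inE; apply: contraNT => /bigcupP no; apply/eqP/rowP => j.
  rewrite !mxE; have := congr1 (fun M : 'M_(L, p) => M j i) eX; rewrite !mxE => ->.
  rewrite big1 // => k _; rewrite !mxE; have [->|nz] := eqVneq (B i (f k)) 0; first by rewrite mulr0.
  by case: no; exists k; rewrite ?inE.
apply: leq_trans (subset_leq_card sub) _.
apply: leq_trans (card_bigcup_le (w := w) _) _; first by move=> k _; apply: cB.
by rewrite cardsT card_ord mxrank_tr leq_mul2r rB orbT.
Qed.

Lemma rank_nonzero_rows (F : fieldType) p n (A : 'M[F]_(p, n)) :
  (\rank A <= #|[set i | row i A != 0%R]|)%N.
Proof.
apply: leq_trans (rkf_card (fun i => row i A) _); apply: mxrankS; apply/row_subP => i.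
have [->|ni] := eqVneq (row i A) 0; first exact: sub0mx.
by apply: (@spanf_mem _ _ _ (fun i => row i A)); rewrite inE.
Qed.

(** Each column of [B *m U^T] involves at most [w] columns of [B], hence at most [w * 2] rows; by
    low rank, few rows of [B] fail to be relations of [U]. The other nonzero rows have weight at
    least 3, while [B] has at most [2 * #|K|] nonzero entries. *)
Lemma coframe_count (F : fieldType) p n L t w (B : 'M[F]_(p, n)) (U : 'M[F]_(L, n))
    (K : {set 'I_n}) :
  sparse B -> (forall i j, j \notin K -> B i j = 0) -> (\rank (B *m U^T) <= t)%N ->
  (forall i, #|[set j in K | U i j != 0%R]| <= w)%N ->
  (forall y : 'rV_n, (forall j, j \notin K -> y 0 j = 0) -> y *m U^T = 0 -> y != 0 ->
     (3 <= weight y)%N) ->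
  (3 * \rank B <= 2 * #|K| + 3 * (t * (w * 2)))%N.
Proof.
move=> sB BK rBU cU simple.
pose T := [set i | row i (B *m U^T) != 0].
have cT : (#|T| <= t * (w * 2))%N.
  apply: low_rank_sparse_rows => // i.
  apply: leq_trans (_ : #|\bigcup_(j in [set j in K | U i j != 0%R]) [set r | B r j != 0%R]| <= _)%N.
    apply: subset_leq_card; apply/subsetP => r; rewrite inE; apply: contraNT => /bigcupP no.
    rewrite mxE big1 // => j _; rewrite mxE.
    have [jK|jK] := boolP (j \in K); last by rewrite BK // mul0r.
    have [->|Uj] := eqVneq (U i j) 0; first by rewrite mulr0.
    have [->|Bj] := eqVneq (B r j) 0; first by rewrite mul0r.
    by case: no; exists j; rewrite !inE ?jK.
  apply: leq_trans (card_bigcup_le (w := 2) _) _; first by move=> j _; apply: sB.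
  by rewrite leq_mul2r cU.
pose N := [set i | row i B != 0].
have rN : (\rank B <= #|N|)%N by apply: rank_nonzero_rows.
have cNT : (#|N| <= #|N :\: T| + #|T|)%N.
  by rewrite -(cardsID T N) addnC leq_add2l subset_leq_card // subsetIr.
have wN : (3 * #|N :\: T| <= 2 * #|K|)%N.
  apply: (@leq_trans (\sum_(i < p) weight (row i B))); last first.
    rewrite /weight; under eq_bigr => i _ do rewrite -sum1_card big_mkcond /=.
    rewrite exchange_big /= mulnC -sum_nat_const [leqRHS]big_mkcond /=.
    apply: leq_sum => j _; case: ifP => jK; last first.
      by rewrite big1 // => i _; rewrite inE mxE BK ?jK // eqxx.
    apply: leq_trans (sB j); rewrite -big_mkcond /= sum1_card.
    apply: subset_leq_card; apply/subsetP => i h.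
    by have : j \in [set k | row i B 0 k != 0] := h; rewrite !inE mxE.
  rewrite mulnC -sum_nat_const [leqRHS](bigID (mem (N :\: T))) /=.
  apply: leq_trans (leq_addr _ _); apply: leq_sum => i; rewrite !inE negbK => /andP[/eqP iT iN].
  by apply: simple => // [j jK|]; rewrite ?mxE ?BK // -row_mul.
lia.
Qed.

(** * Gadgets along a path *)

Section Segments.
Variables (v e : nat) (s t : 'I_e -> 'I_v) (phi : 'I_v -> nat).
Variables (vs : nat -> 'I_v) (ps : nat -> 'I_e) (rho G : nat).
Hypotheses (rho2 : (1 < rho)%N) (G2 : (1 < G)%N).
Let N := (3 * G * rho)%N.
Hypothesis ps_ends : forall c, (c < N)%N ->
  (s (ps c) = vs c /\ t (ps c) = vs c.+1) \/ (s (ps c) = vs c.+1 /\ t (ps c) = vs c).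
Hypothesis phi_vs : forall c, (c <= N)%N -> phi (vs c) = c.

Definition seg : finType := ('I_G * 'I_3)%type.
Definition gadget : finType := (bool * 'I_G)%type.

Definition idx (x : seg) : nat := (x.1 * 3 + x.2)%N.

Definition terminals : {set 'I_v} := [set vs (i * rho) | i : 'I_(3 * G).+1].

(* Each gadget meets three segments, and each segment lies in two gadgets: its
   first edge in one of the first kind, its last edge in one of the second.  The
   cyclic shift makes the triples of the two kinds different. *)
Definition meets (g : gadget) (a : 'I_3) : seg :=
  (if g.1 && (a == ord0) then ordS g.2 else g.2, a).

Definition pos (g : gadget) (a : 'I_3) : nat :=
  (idx (meets g a) * rho + (if g.1 then rho.-1 else 0))%N.

Definition gedge (g : gadget) (a : 'I_3) : 'I_e := ps (pos g a).

Lemma idx_inj : injective idx.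
Proof.
move=> [g a] [g' a']; rewrite /idx /= => E.
have ea : a = a'.
  by apply: val_inj; move: (congr1 (modn^~ 3) E); rewrite !modnMDl !modn_small.
have eg : g = g'.
  by apply: val_inj; move: (congr1 (divn^~ 3) E); rewrite !divnMDl // !divn_small ?addn0.
by rewrite ea eg.
Qed.

Lemma idx_lt x : (idx x < 3 * G)%N.
Proof. by case: x => g a; rewrite /idx /=; have := ltn_ord g; have := ltn_ord a; lia. Qed.

Lemma idx_onto c : (c < 3 * G)%N -> exists x, idx x = c.
Proof.
move=> c3; have h1 : (c %/ 3 < G)%N by lia.
have h2 : (c %% 3 < 3)%N by rewrite ltn_mod.
by exists (Ordinal h1, Ordinal h2); rewrite /idx /=; lia.
Qed.

Lemma segment_lt x c : (c < rho)%N -> (idx x * rho + c < N)%N.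
Proof. by have := idx_lt x; rewrite /N; nia. Qed.

Lemma pos_div g a : (pos g a %/ rho = idx (meets g a))%N.
Proof.
by rewrite /pos divnMDl ?(ltnW rho2) // divn_small ?addn0 //; case: g.1 => //; lia.
Qed.

Lemma pos_lt g a : (pos g a < N)%N.
Proof. by apply: segment_lt; case: g.1 => //; lia. Qed.

Lemma ps_level c : (c < N)%N -> minn (phi (s (ps c))) (phi (t (ps c))) = c.
Proof.
move=> cN; case: (ps_ends cN) => -[-> ->]; rewrite !phi_vs ?(ltnW cN) //; lia.
Qed.

Lemma ps_inj c c' : (c < N)%N -> (c' < N)%N -> ps c = ps c' -> c = c'.
Proof. by move=> cN c'N E; rewrite -(ps_level cN) E ps_level. Qed.

Lemma meets_inj g g' a : g.1 = g'.1 -> meets g a = meets g' a -> g = g'.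
Proof.
case: g g' => b g [b' g'] /= <-; rewrite /meets /= => /(congr1 fst) /=.
by case: (_ && _) => [/(can_inj (@ordSK G))|] ->.
Qed.

Lemma gedge_inj g g' a a' : gedge g a = gedge g' a' -> g = g' /\ a = a'.
Proof.
move/(ps_inj (pos_lt _ _) (pos_lt _ _)) => E.
have Em : meets g a = meets g' a' by apply: idx_inj; rewrite -!pos_div E.
have ea : a = a' by case: Em.
subst a'; split=> //; apply: (meets_inj (a := a)) => //.
by move: E; rewrite /pos Em; case: g.1; case: g'.1 => //; lia.
Qed.

Lemma terminal i : (i <= 3 * G)%N -> vs (i * rho) \in terminals.
Proof. by move=> i3; apply/imsetP; exists (Ordinal (i3 : (i < (3 * G).+1)%N)). Qed.

Lemma gedge_terminal g a : (s (gedge g a) \in terminals) || (t (gedge g a) \in terminals).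
Proof.
have [u uT /orP[/eqP->|/eqP->]] : exists2 u, u \in terminals &
    (s (gedge g a) == u) || (t (gedge g a) == u); last 2 first.
- by rewrite uT.
- by rewrite uT orbT.
(* The kind [g.1] counts as 0 or 1: the first edge of a segment begins at its lower terminal, the
   last edge ends at its upper one. *)
exists (vs ((idx (meets g a) + g.1) * rho)).
  by apply: terminal; have := idx_lt (meets g a); case: g.1; lia.
have -> : ((idx (meets g a) + g.1) * rho = pos g a + g.1)%N.
  by rewrite /pos mulnDl; case: g.1; lia.
case: (ps_ends (pos_lt g a)); rewrite -/(gedge g a) => -[-> ->].
  by case: g.1; rewrite ?addn0 ?addn1 eqxx ?orbT.
by case: g.1; rewrite ?addn0 ?addn1 eqxx ?orbT.
Qed.

Lemma terminalP u : u \in terminals -> exists2 i, (i <= 3 * G)%N & u = vs (i * rho).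
Proof. by case/imsetP => i _ ->; exists i => //; rewrite -ltnS. Qed.

Lemma phi_terminal i : (i <= 3 * G)%N -> phi (vs (i * rho)) = (i * rho)%N.
Proof. by move=> i3; apply: phi_vs; rewrite /N leq_mul2r i3 orbT. Qed.

Lemma terminals_dvd u : u \in terminals -> (rho %| phi u)%N.
Proof. by case/terminalP => i i3 ->; rewrite phi_terminal // dvdn_mull. Qed.

Lemma terminals_phi_inj : {in terminals &, injective phi}.
Proof.
move=> u w /terminalP[i i3 ->] /terminalP[j j3 ->].
by rewrite !phi_terminal // => ->.
Qed.

Lemma card_terminals : (#|terminals| <= 3 * G + 1)%N.
Proof. by apply: leq_trans (leq_imset_card _ _) _; rewrite card_ord addn1. Qed.

Variable F : fieldType.
Hypothesis two_neq0 : (2 : F) != 0.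

Let nq := #|{: gadget * 'I_4}|.
Let M := gadget_mx s t terminals gedge F.

Definition orient (c : nat) : F := if s (ps c) == vs c then 1 else -1.

Lemma orient_neq0 c : orient c != 0.
Proof. by rewrite /orient; case: ifP => _; rewrite ?oppr_eq0 oner_eq0. Qed.

Lemma orient_evec c : (c < N)%N ->
  orient c *: evec F s t (ps c) = delta_mx 0 (vs c) - delta_mx 0 (vs c.+1).
Proof.
move=> cN; rewrite /evec /orient; case: (ps_ends cN) => -[-> ->]; first by rewrite eqxx scale1r.
rewrite (_ : _ == _ = false) ?scaleN1r ?opprB //.
by apply/eqP => /(congr1 phi); rewrite !phi_vs ?(ltnW cN) //; lia.
Qed.

Definition segflow (x : seg) : 'rV[F]_e :=
  \sum_(c < rho) orient (idx x * rho + c) *: delta_mx 0 (ps (idx x * rho + c)).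

(** The divergence telescopes to the two ends of the segment, which are terminals. *)
Lemma segflow_cut x : segflow x *m cutmx s t terminals F = 0.
Proof.
rewrite cutmx_incmx mulmxA.
have -> : segflow x *m incmx F s t =
    delta_mx 0 (vs (idx x * rho)) - delta_mx 0 (vs ((idx x).+1 * rho)).
  rewrite mulmx_suml.
  pose f k : 'rV[F]_v := - delta_mx 0 (vs (idx x * rho + k)).
  transitivity (\sum_(0 <= k < rho) (f k.+1 - f k)); last first.
    by rewrite telescope_sumr // /f addn0 opprK addrC mulSn [(rho + _)%N]addnC.
  rewrite big_mkord; apply: eq_bigr => c _.
  rewrite -scalemxAl -rowE rowK orient_evec ?segment_lt // /f opprK addnS addrC //.
have dl u : u \in terminals ->
    delta_mx 0 u *m diag_mx (\row_w (w \notin terminals)%:R) = 0 :> 'rV[F]_v.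
  move=> uT; apply/rowP => w; rewrite mul_mx_diag !mxE eqxx /=.
  by case: eqP => [->|]; rewrite ?uT ?mulr0 ?mul0r.
rewrite mulmxBl !dl ?subrr //; apply: terminal; have := idx_lt x; lia.
Qed.

Lemma segflow_path x c : (c < N)%N ->
  segflow x 0 (ps c) = if (c %/ rho)%N == idx x then orient c else 0.
Proof.
move=> cN; rewrite summxE.
have E (k : 'I_rho) : (orient (idx x * rho + k) *: delta_mx 0 (ps (idx x * rho + k))) 0 (ps c) =
    if c == (idx x * rho + k)%N then orient c else 0 :> F.
  rewrite !mxE eqxx /=; case: (eqVneq (ps c)) => [/ps_inj->|ne]; rewrite ?segment_lt //.
    by rewrite eqxx mulr1.
  by rewrite mulr0; case: eqP => // ec; rewrite -ec eqxx in ne.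
under eq_bigr => k _ do rewrite E.
case: eqP => [ec|nc]; last first.
  rewrite big1 // => k _; case: eqP => // ec; case: nc.
  by rewrite ec divnMDl ?(ltnW rho2) // divn_small ?addn0.
have cr : (c %% rho < rho)%N by rewrite ltn_mod ltnW.
rewrite (bigD1 (Ordinal cr)) //= -ec -divn_eq eqxx big1 ?addr0 // => k nk.
case: eqP => // E'; case/eqP: nk; apply: val_inj => /=.
by rewrite {1}E' modnMDl modn_small.
Qed.

Lemma segflow_off x j : (forall c, (c < N)%N -> j <> ps c) -> segflow x 0 j = 0.
Proof.
move=> nj; rewrite summxE big1 // => c _; rewrite !mxE eqxx /=.
case: (eqVneq j (ps _)) => [ej|]; last by rewrite mulr0.
by case: (nj _ (segment_lt x (ltn_ord c))).
Qed.

Lemma segflow_gedge x g a :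
  segflow x 0 (gedge g a) = if meets g a == x then orient (pos g a) else 0.
Proof. by rewrite segflow_path ?pos_lt // pos_div (inj_eq idx_inj). Qed.

Definition segword (x : seg) : 'rV[F]_(e + nq) :=
  segflow x *m row_mx 1%:M (qmx gedge F).

Definition anchor (x : seg) : 'I_(e + nq) := lshift nq (ps (idx x * rho)).
Definition extra (p : gadget * 'I_4) : 'I_(e + nq) := rshift e (enum_rank p).

Lemma segwordl x j : segword x 0 (lshift nq j) = segflow x 0 j.
Proof. by rewrite /segword mul_mx_row row_mxEl mulmx1. Qed.

Lemma segword_anchor x y :
  segword x 0 (anchor y) = if y == x then orient (idx y * rho) else 0.
Proof.
rewrite segwordl segflow_path; last first.
  by have := segment_lt y (ltnW rho2); rewrite addn0.
by rewrite mulnK ?(ltnW rho2) // (inj_eq idx_inj).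
Qed.

Lemma segword_extra x p : segword x 0 (extra p) =
  \sum_(a < 3) (if meets p.1 a == x then orient (pos p.1 a) * (nf (3 + p.2) a)%:~R else 0).
Proof.
rewrite /segword mul_mx_row row_mxEr mxE.
under eq_bigr => i _ do rewrite mxE enum_rankK mulr_sumr.
rewrite exchange_big /=; apply: eq_bigr => a _.
rewrite (bigD1 (gedge p.1 a)) //= eqxx mul1r big1 ?addr0 => [|i].
  by rewrite segflow_gedge; case: ifP; rewrite ?mul0r.
by rewrite eq_sym => /negPf->; rewrite mul0r mulr0.
Qed.

Lemma segword_meets p a : segword (meets p.1 a) 0 (extra p) =
  orient (pos p.1 a) * (nf (3 + p.2) a)%:~R.
Proof.
rewrite segword_extra (bigD1 a) //= eqxx big1 ?addr0 // => b ba.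
by case: eqP => // -[_ eb]; rewrite eb eqxx in ba.
Qed.

Lemma segword_off x p : (forall a, meets p.1 a != x) -> segword x 0 (extra p) = 0.
Proof. by move=> h; rewrite segword_extra big1 // => a _; rewrite (negPf (h a)). Qed.

Lemma nf_unit (k : 'I_4) (a : 'I_3) : ((nf (3 + k) a)%:~R : F) != 0.
Proof.
by case: k => [[|[|[|[|]]]]] // i; case: a => [[|[|[|]]]] // j;
  rewrite /nf /= ?mulrN1z ?oppr_eq0 oner_eq0.
Qed.

Lemma nf_row_inj (k k' : 'I_4) :
  (forall a : 'I_3, (nf (3 + k) a)%:~R = (nf (3 + k') a)%:~R :> F) -> k = k'.
Proof.
have pm : (1 : F) <> (-1)%:~R.
  by move/eqP; rewrite mulrN1z -subr_eq0 opprK (negPf two_neq0).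
have mp : (-1)%:~R <> 1 :> F by move/esym.
move=> h; have {h} := (h (inord 1), h (inord 2)); rewrite !inordK //.
by case: k => [[|[|[|[|]]]]] // i; case: k' => [[|[|[|[|]]]]] // j; rewrite /nf /= => -[h1 h2];
  try (by apply: val_inj); try (by case: (pm h1)); try (by case: (pm h2));
  try (by case: (mp h1)); try (by case: (mp h2)).
Qed.

(** The minor lives on [kept]: the first edge of each segment stands for the whole segment, and all
    extra points remain. Words are made to vanish on the off-path edges in [dropped], and the other
    path edges, in [merged], are projected away. *)
Definition kept : {set 'I_(e + nq)} := (anchor @: setT) :|: (extra @: setT).
Definition merged : {set 'I_(e + nq)} :=
  [set lshift nq (ps c) | c : 'I_N & ~~ (rho %| c)%N].
Definition dropped : {set 'I_(e + nq)} := ~: (kept :|: merged).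

Lemma anchor_kept x : anchor x \in kept.
Proof. by rewrite inE imset_f. Qed.

Lemma extra_kept p : extra p \in kept.
Proof. by rewrite inE orbC imset_f. Qed.

Lemma anchor_inj : injective anchor.
Proof.
move=> x y /lshift_inj /ps_inj E; apply: idx_inj; apply/eqP.
have h z : (idx z * rho < N)%N by have := segment_lt z (ltnW rho2); rewrite addn0.
by move/eqP: (E (h x) (h y)); rewrite eqn_pmul2r ?(ltnW rho2).
Qed.

Lemma extra_inj : injective extra.
Proof. by move=> p q /rshift_inj/enum_rank_inj. Qed.

Lemma anchor_extra x p : anchor x != extra p.
Proof. by rewrite eq_lrshift. Qed.

Lemma card_kept : #|kept| = (11 * G)%N.
Proof.
rewrite /kept cardsU !card_imset; [|exact: extra_inj|exact: anchor_inj].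
rewrite (_ : _ :&: _ = set0); last first.
  apply/setP => j; rewrite !inE; apply/negP => /andP[/imsetP[x _ ->] /imsetP[p _ /eqP]].
  by rewrite (negPf (anchor_extra _ _)).
rewrite cards0 subn0 !cardsT !card_prod card_bool !card_ord; lia.
Qed.

Lemma path_kept_merged c : (c < N)%N -> lshift nq (ps c) \in kept :|: merged.
Proof.
move=> cN; rewrite inE; case: (boolP (rho %| c)%N) => [/dvdnP[i ec]|nd]; apply/orP; [left|right].
  have [x ex] : exists x, idx x = i by apply: idx_onto; move: cN; rewrite ec /N; nia.
  by rewrite ec -ex; apply: anchor_kept.
by apply/imsetP; exists (Ordinal cN); rewrite ?inE.
Qed.

Lemma kept_merged_disjoint : [disjoint kept & merged].
Proof.
apply/pred0P => j /=; apply/negP => /andP[jK /imsetP[c]]; rewrite inE => nd ej.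
move: jK; rewrite {}ej inE => /orP[/imsetP[x _ /lshift_inj E]|/imsetP[p _ /eqP]]; last first.
  by rewrite eq_lrshift.
have h : (idx x * rho < N)%N by have := segment_lt x (ltnW rho2); rewrite addn0.
by move: nd; rewrite (ps_inj (ltn_ord c) h E) dvdn_mull.
Qed.

Lemma droppedP j : j \in dropped ->
  exists2 l, j = lshift nq l & forall c, (c < N)%N -> l <> ps c.
Proof.
rewrite inE => jd; case: (splitP j) => [l|p] ej.
  have {}ej : j = lshift nq l by apply: val_inj.
  exists l => // c cN el; move: jd; rewrite ej el.
  by rewrite path_kept_merged.
have {}ej : j = extra (enum_val p) by apply: val_inj; rewrite /= enum_valK.
by move: jd; rewrite ej inE extra_kept.
Qed.

Definition segmx : 'M[F]_(#|seg|, e + nq) := \matrix_i segword (enum_val i).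

Lemma segmx_code : (segmx <= M)%MS.
Proof.
apply/row_subP => i; rewrite rowK; apply: submxMr.
by apply/sub_kermxP; apply: segflow_cut.
Qed.

Lemma segmx_dropped i j : j \in dropped -> segmx i j = 0.
Proof.
by case/droppedP => l -> nl; rewrite mxE segwordl segflow_off.
Qed.

Definition anchormx : 'M[F]_(e + nq, #|seg|) :=
  \matrix_(j, i) (j == anchor (enum_val i))%:R.

Lemma mul_anchormx m (A : 'M[F]_(m, e + nq)) i k :
  (A *m anchormx) i k = A i (anchor (enum_val k)).
Proof.
rewrite mxE (bigD1 (anchor (enum_val k))) //= mxE eqxx mulr1 big1 ?addr0 // => j nj.
by rewrite mxE (negPf nj) mulr0.
Qed.

Lemma segmx_free : row_free segmx.
Proof.
have E : segmx *m anchormx = diag_mx (\row_i orient (idx (enum_val i) * rho)).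
  apply/matrixP => i k; rewrite mul_anchormx mxE segword_anchor !mxE.
  rewrite (inj_eq enum_val_inj) eq_sym; case: eqP => [->|]; by rewrite ?mulr1n ?mulr0n.
rewrite -row_leq_rank; apply: leq_trans (mxrankM_maxl segmx anchormx).
by rewrite E mxrank_unit // diag_mx_unit // => j; rewrite mxE orient_neq0.
Qed.

(* A flow supported on the path is conserved at its inner vertices, hence is
   determined by one value on each segment. *)
Lemma path_flow0 (z : 'rV[F]_e) : z *m cutmx s t terminals F = 0 ->
  (forall j, (forall c, (c < N)%N -> j <> ps c) -> z 0 j = 0) ->
  (forall x, z 0 (ps (idx x * rho)) = 0) -> z = 0.
Proof.
move=> zc zoff z0.
have main c : (c < N)%N -> z 0 (ps c) = 0.
  elim: c => [|c IH] cN.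
    have [x ex] : exists x, idx x = 0%N by apply: idx_onto; lia.
    by have := z0 x; rewrite ex mul0n.
  case: (boolP (rho %| c.+1)%N) => [/dvdnP[i ec]|nd].
    have [x ex] : exists x, idx x = i by apply: idx_onto; move: cN; rewrite ec /N; nia.
    by rewrite ec -ex z0.
  have zp := IH (ltnW cN).
  have nX : vs c.+1 \notin terminals.
    by apply: contra nd => /terminals_dvd; rewrite phi_vs // ltnW.
  have := congr1 (fun B : 'rV_v => B 0 (vs c.+1)) zc; rewrite !mxE (bigD1 (ps c.+1)) //=.
  rewrite big1 ?addr0 => [|j nj]; last first.
    have [/existsP[c' /eqP ej]|no] := boolP [exists c' : 'I_N, j == ps c']; last first.
      rewrite zoff ?mul0r // => c' c'N ej; case/negP: no.
      by apply/existsP; exists (Ordinal c'N); apply/eqP.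
    have [ec|ncc] := eqVneq (c' : nat) c; first by rewrite ej ec zp mul0r.
    have ncc' : (c' : nat) != c.+1 by apply: contraNneq nj => <-; rewrite ej.
    have nv d : (d <= N)%N -> d != c.+1 -> vs d == vs c.+1 = false.
      move=> dN nd'; apply/negP => /eqP/(congr1 phi); rewrite !phi_vs // ?(ltnW cN) //.
      by move/eqP; rewrite (negPf nd').
    have c'N := ltn_ord c'.
    rewrite mxE ej; case: (ps_ends c'N) => -[-> ->];
      by rewrite !nv ?(ltnW c'N) // ?subrr ?mulr0 // eqSS.
  rewrite mxE nX mul1r.
  have nvv : vs c.+2 == vs c.+1 = false.
    by apply/negP => /eqP/(congr1 phi); rewrite !phi_vs ?(ltnW cN) //; lia.
  case: (ps_ends cN) => -[-> ->]; rewrite eqxx nvv ?subr0 ?sub0r ?mulrN1 ?mulr1 //.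
  by move/eqP; rewrite oppr_eq0 => /eqP.
apply/rowP => j; rewrite mxE.
have [/existsP[c /eqP->]|no] := boolP [exists c : 'I_N, j == ps c]; first exact: main.
apply: zoff => c cN ej; case/negP: no.
by apply/existsP; exists (Ordinal cN); apply/eqP.
Qed.

(** A word vanishing on the off-path edges comes from a path flow, which by [path_flow0] is
    determined by its anchor coordinates. *)
Lemma rank_dropped : (\rank (vanishing M dropped) <= #|seg|)%N.
Proof.
set V := vanishing _ _; have := mxrank_mul_ker V anchormx.
rewrite (_ : (V :&: kermx anchormx)%MS = 0); last first.
  apply/eqP; rewrite -submx0; apply/row_subP => i.
  have : (row i (V :&: kermx anchormx)%MS <= V :&: kermx anchormx)%MS by apply: row_sub.
  move: (row i _) => w; rewrite sub_capmx => /andP[/vanishingP[wM wd] /sub_kermxP wa].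
  have [wc we] := gadget_word wM.
  rewrite we (_ : lsubmx w = 0) ?mul0mx ?sub0mx //; apply: path_flow0 => // [j nj|x].
    rewrite mxE; apply: wd; rewrite inE; apply/negP; rewrite inE.
    case/orP => [|/imsetP[c _ /lshift_inj]]; last exact: nj.
    rewrite inE => /orP[/imsetP[x _ /lshift_inj]|/imsetP[p _ /eqP]]; last by rewrite eq_lrshift.
    by apply: nj; have := segment_lt x (ltnW rho2); rewrite addn0.
  have := congr1 (fun B : 'rV_#|seg| => B 0 (enum_rank x)) wa.
  by rewrite mul_anchormx enum_rankK !mxE.
rewrite mxrank0 addn0 => <-; exact: rank_leq_col.
Qed.

(** The bound counts one anchor and four extra points for each of the two gadgets that meet the
    segment, one of each kind. *)
Lemma segmx_weight i : (#|[set j in kept | segmx i j != 0%R]| <= 9)%N.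
Proof.
set x := enum_val i.
pose Q := [set p : gadget * 'I_4 | [exists a, meets p.1 a == x]].
have sub : [set j in kept | segmx i j != 0] \subset anchor x |: (extra @: Q).
  apply/subsetP => j; rewrite !inE mxE -/x => /andP[/orP[/imsetP[y _ ->]|/imsetP[p _ ->]] nz].
    move: nz; rewrite segword_anchor; case: (eqVneq y x) => [->|_]; first by rewrite eqxx.
    by rewrite eqxx.
  apply/orP; right; apply: imset_f; rewrite inE; apply: contraNT nz => /existsPn h.
  by rewrite segword_off.
apply: leq_trans (subset_leq_card sub) _; apply: leq_trans (leq_card_setU _ _) _.
rewrite cards1 (leq_add2l 1 _ 8); apply: leq_trans (leq_imset_card _ _) _.
pose h (p : gadget * 'I_4) := (p.1.1, p.2).
have ih : {in Q &, injective h}.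
  move=> [g k] [g' k']; rewrite !inE => /existsP[a /eqP ea] /existsP[a' /eqP ea'] [eb ek].
  rewrite /= in ea ea' eb ek *; have eaa : a = a' by rewrite -ea' in ea; case: ea.
  by rewrite -eaa -ea in ea'; rewrite ek (meets_inj eb (esym ea')).
rewrite -(card_in_imset ih); apply: leq_trans (max_card _) _.
by rewrite card_prod card_bool card_ord.
Qed.

(** Gadgets of one kind differ in every position. For different kinds with the same index, the
    cyclic shift separates position 0 because [1 < G]; with different indices, the unshifted
    position 1 does. *)
Lemma meets_sep (g g' : gadget) : g != g' ->
  exists a, forall b, meets g' b != meets g a.
Proof.
move=> ne; case: (eqVneq g.1 g'.1) => [e1|n1].
  exists ord0 => b; apply: contraNneq ne => E.
  have eb : b = ord0 by case: E.
  by rewrite eb in E; rewrite (meets_inj e1 (esym E)).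
case: (eqVneq g.2 g'.2) => [e2|n2].
  exists ord0 => b; apply/eqP => E; have eb : b = ord0 by case: E.
  move/(congr1 fst): E; rewrite eb /meets /= e2 !andbT.
  have nS : ordS g'.2 != g'.2.
    apply/eqP => /(congr1 val) /=; have := ltn_ord g'.2.
    have [lt|] := ltnP (g'.2).+1 G; first by rewrite modn_small //; lia.
    move=> ge lt; have -> : (g'.2).+1 = G by apply/eqP; rewrite eqn_leq lt ge.
    by rewrite modnn => e0; move: ge; rewrite -e0 leqNgt G2.
  by case: g.1 g'.1 n1 => -[] // _ /eqP; rewrite ?(negPf nS) // eq_sym (negPf nS).
exists (inord 1) => b; apply/eqP => E; have eb : b = inord 1 by case: E.
move/(congr1 fst): E; rewrite eb /meets /=.
have -> : (inord 1 == ord0 :> 'I_3) = false by apply/eqP => /(congr1 val); rewrite /= inordK.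
by rewrite !andbF => /eqP; rewrite eq_sym (negPf n2).
Qed.

(** This says that no two columns on [kept] are parallel. An anchor involves one segment and an
    extra point three; extra points of distinct gadgets are told apart by [meets_sep], those of one
    gadget by their sign patterns. *)
Lemma segword_sep j1 j2 (y1 y2 : F) : j1 \in kept -> j2 \in kept -> j1 != j2 ->
  y1 != 0 -> y2 != 0 -> exists x, y1 * segword x 0 j1 + y2 * segword x 0 j2 != 0.
Proof.
have AQ x0 p (y y' : F) : y' != 0 ->
    exists x, y * segword x 0 (anchor x0) + y' * segword x 0 (extra p) != 0.
  move=> y'0; have [a na] : exists a, meets p.1 a != x0.
    have [e0|] := eqVneq (meets p.1 ord0) x0; last by exists ord0.
    exists ord_max; rewrite -e0; by apply/eqP => /(congr1 (fun x : seg => val x.2)).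
  exists (meets p.1 a); rewrite segword_anchor [x0 == _]eq_sym (negPf na) mulr0 add0r segword_meets.
  by rewrite !mulf_neq0 ?orient_neq0 ?nf_unit.
rewrite !inE => /orP[/imsetP[x1 _ ->]|/imsetP[p1 _ ->]] /orP[/imsetP[x2 _ ->]|/imsetP[p2 _ ->]].
- rewrite (inj_eq anchor_inj) => ne y10 y20; exists x1; rewrite !segword_anchor eqxx.
  by rewrite [x2 == _]eq_sym (negPf ne) mulr0 addr0 mulf_neq0 // orient_neq0.
- by move=> _ _; apply: AQ.
- by move=> _ y10 _; have [x nx] := AQ x2 p1 y2 y1 y10; exists x; rewrite addrC.
rewrite (inj_eq extra_inj) => ne y10 y20.
have [eg|ng] := eqVneq p1.1 p2.1; last first.
  have [a na] := meets_sep ng; exists (meets p1.1 a).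
  by rewrite segword_meets segword_off // mulr0 addr0 !mulf_neq0 ?orient_neq0 ?nf_unit.
apply/existsP; apply: contraNT ne => /existsPn h.
have E (a : 'I_3) : y1 * (nf (3 + p1.2) a)%:~R + y2 * (nf (3 + p2.2) a)%:~R = 0.
  have := h (meets p1.1 a); rewrite negbK segword_meets eg segword_meets.
  rewrite mulrCA [y2 * _]mulrCA -mulrDr mulf_eq0 (negPf (orient_neq0 _)) => /eqP//.
have n0 (k : 'I_4) : nf (3 + k) (ord0 : 'I_3) = 1 by case: k => [[|[|[|[|]]]]].
have y2E : y2 = - y1.
  by have := E ord0; rewrite !n0 !mulr1 addrC => /eqP; rewrite addr_eq0 => /eqP.
have ek : p1.2 = p2.2.
  apply: nf_row_inj => a; have := E a; rewrite y2E mulNr -mulrBr => /eqP.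
  by rewrite mulf_eq0 (negPf y10) subr_eq0 => /eqP.
by rewrite [p1]surjective_pairing [p2]surjective_pairing eg ek.
Qed.

Lemma segmx_simple (y : 'rV[F]_(e + nq)) : (forall j, j \notin kept -> y 0 j = 0) ->
  y *m segmx^T = 0 -> y != 0 -> (3 <= weight y)%N.
Proof.
move=> yK yU /rV0Pn[j1 y1]; set S := [set j | y 0 j != 0].
have rel x : \sum_(j in S) y 0 j * segword x 0 j = 0.
  have E : (y *m segmx^T) 0 (enum_rank x) = 0 by rewrite yU mxE.
  rewrite -[RHS]E mxE [LHS]big_mkcond /=; apply: eq_bigr => j _.
  rewrite [segmx^T _ _]mxE [segmx _ _]mxE enum_rankK inE.
  by case: (eqVneq (y 0 j) 0) => [->|_]; rewrite ?mul0r.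
have j1S : j1 \in S by rewrite inE.
have SK j : j \in S -> j \in kept by rewrite inE; apply: contraR => /yK->.
rewrite /weight -/S ltnNge; apply/negP => cS.
have [S1|[j2]] := set_0Vmem (S :\ j1).
  have [x nx] : exists x, segword x 0 j1 != 0.
    have := SK _ j1S; rewrite inE => /orP[/imsetP[x _ ->]|/imsetP[p _ ->]].
      by exists x; rewrite segword_anchor eqxx orient_neq0.
    by exists (meets p.1 ord0); rewrite segword_meets mulf_neq0 ?orient_neq0 ?nf_unit.
  have := rel x; rewrite (big_setD1 j1) //= S1 big_set0 addr0 => /eqP.
  by rewrite mulf_eq0 (negPf y1) (negPf nx).
move=> j2S; have j2S' := subsetP (subsetDl _ _) _ j2S.
move: (j2S); rewrite in_setD1 => /andP[nj _].
have y2 : y 0 j2 != 0 by rewrite inE in j2S'.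
have S2 : S :\ j1 :\ j2 = set0.
  apply/eqP; rewrite -cards_eq0; have := cardsD1 j1 S; have := cardsD1 j2 (S :\ j1).
  by rewrite j1S j2S; lia.
rewrite eq_sym in nj; have [x nx] := segword_sep (SK _ j1S) (SK _ j2S') nj y1 y2.
have := rel x; rewrite (big_setD1 j1) //= (big_setD1 j2) //= S2 big_set0 addr0 => /eqP.
by rewrite (negPf nx).
Qed.

(** With row weight at most 9, the two counts combine to 24 G <= 3 rank B + 3 r <= 22 G + 57 r. *)
Lemma gadget_not_coframe r (P : rmatroid F (e + nq)) : (57 * r < 2 * G)%N ->
  frame P -> ~ perturbation r (rdual P) (RMatroid M).
Proof.
move=> r57 frP /(perturbation_coframe frP)[p [A [m [W [sA WA WM rA rM]]]]].
have cov j : [|| j \in kept, j \in merged | j \in dropped].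
  rewrite [j \in dropped]in_setC [j \in kept :|: merged]in_setU.
  by case: (j \in kept); case: (j \in merged).
have dKd : [disjoint kept & dropped].
  apply/pred0P => j /=; rewrite [j \in dropped]in_setC [j \in kept :|: merged]in_setU.
  by case: (j \in kept).
have [B [sB BK rB cK]] := coframe_minor sA WA rA WM rM segmx_code segmx_free
  segmx_dropped rank_dropped cov kept_merged_disjoint dKd.
have := coframe_count sB BK rB segmx_weight segmx_simple.
move: cK; rewrite card_kept card_prod !card_ord; lia.
Qed.

End Segments.

(* Choice of parameters and conclusion *)
Local Close Scope ring_scope.

Theorem theorem3p6 (k t : nat) (hk : 0 < k) (ht : 0 < t) :
  exists (n : nat) (M : rmatroid 'F_3 n),
    [/\ dyadic (underlying M),
        vertically_connected k (underlying M),
        (forall N : rmatroid 'F_3 n, frame N -> ~ perturbation t N M)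
      & (forall N : rmatroid 'F_3 n, frame N -> ~ perturbation t (rdual N) M)].
Proof.
(* [G] satisfies 57 t < 2 G; [kappa] allows for a loss of two per terminal, of which there are at
   most 3 G + 1; the term [17 * t.+1] in [rho] is what the frame count below needs. *)
pose G := 29 * t; pose kappa := k + 2 * (3 * G + 1); pose rho := 2 * kappa + 17 * t.+1.
have k0 : 0 < kappa by rewrite addn_gt0 hk.
have [v [e [s [u [phi [vs [ps]]]]]]] :=
  @linked_girth_graph 'F_3 kappa rho (3 * G * rho) (2 * kappa + 4 * t + 2 * G + 1) k0 (leq_addr _ _).
case=> girth linked lip [ends levels] [dens e_big].
have rho2 : 1 < rho by rewrite /rho; lia.
have G2 : 1 < G by rewrite /G; lia.
have two3 : ((2 : 'F_3) != 0)%R by [].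
have two5 : ((2 : 'F_5) != 0)%R by [].
have dvd := terminals_dvd levels.
have inj := terminals_phi_inj levels.
pose X := terminals vs rho G; pose ge := gedge ps rho (G := G).
pose M := gadget_mx s u X ge 'F_3.
exists _, (RMatroid M); split.
- split; first by exists e, M.
  exists e, (gadget_mx s u X ge 'F_5); apply: gadget_vindep => //.
    by move=> *; apply: (gedge_inj rho2 G2 ends levels).
  by move=> *; apply: (gedge_terminal rho2 G2 ends).
- apply: (gadget_connected girth lip dvd inj linked) => //.
  by rewrite leq_add2l leq_mul2l card_terminals.
- move=> N frN /(perturbation_frame frN)[p [A [m [W [sA WA WM rA rM]]]]].
  have wt (w : 'rV_(e + #|{: gadget G * 'I_4}|)) : (w <= W)%MS -> (w != 0)%R -> rho <= weight w.
    move=> wW w0; have [wc we] := gadget_word (submx_trans wW WM).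
    have z0 : (lsubmx w != 0)%R by apply: contraNneq w0 => z0; rewrite we z0 mul0mx.
    apply: leq_trans (flow_support_rank girth lip dvd inj wc z0) _.
    apply: leq_trans (rkf_card _ _) _; rewrite -(card_imset _ (@lshift_inj _ #|{: gadget G * 'I_4}|)).
    by apply: subset_leq_card; apply/subsetP => j /imsetP[i]; rewrite !inE mxE => h ->.
  have cq : #|{: gadget G * 'I_4}| = 8 * G.
    by rewrite !card_prod card_bool !card_ord; lia.
  have cnt := frame_weight sA WA rA wt.
  (* The rank of [A] is at least e - t - rk, and [dens] bounds rk by e / 4 + kappa. Groups of [t.+1]
     rows of total weight at least 17 (t + 1) then need more than the 2 (e + 8 G) entries available,
     since [e_big] makes [e] large. *)
  have hA : e <= \rank A + t + rkf (evec 'F_3 s u) [set: 'I_e].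
    rewrite -[leqLHS](rank_gadget_mx 'F_3 s u X ge); apply: leq_add; last exact: rk_cut_le.
    by apply: leq_trans rM _; rewrite leq_add2r mxrankS.
  have := divn_eq (\rank A) t.+1; have := ltn_pmod (\rank A) (ltn0Sn t).
  have hb b : b * (17 * t.+1) <= b * rho by rewrite leq_mul2l leq_addl orbT.
  move: cnt hA dens (hb (\rank A %/ t.+1)).
  move: (rkf _ _) (\rank A) => rk q; rewrite cq; move: (_ %/ _) (_ %% _) e_big => b c.
  lia.
- move=> N; apply: (gadget_not_coframe rho2 G2 ends levels two3); rewrite /G; lia.
Qed.
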